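(* Let $Q$ be a Dynkin quiver and $v\in kQ_0$ a weight. Then the quiver Heisenberg algebra ${}^v\Lambda(Q)$ is finite-dimensional over $k$ if and only if $v$ is regular.
   Context: $k$ is a field. A Dynkin quiver is a quiver $Q=(Q_0,Q_1,h,t)$ whose underlying graph is Dynkin of type $A_n,D_n,E_6,E_7,E_8$; an arrow $\alpha$ goes from its tail $t(\alpha)$ to its head $h(\alpha)$. Paths are composed from left to right, $e_i$ is the trivial path at $i$. A weight is $v=(v_i)\in kQ_0=k^{Q_0}$; it is regular if $\sum_{i\in Q_0}v_i\dim(e_iN)\ne0$ in $k$ for every indecomposable finite-dimensional left $kQ$-module $N$. $\overline Q$ is the double of $Q$: add for each $\alpha\in Q_1$ an arrow $\alpha^*:h(\alpha)\to t(\alpha)$. Put $\rho_i=\sum_{t(\alpha)=i}\alpha\alpha^*-\sum_{h(\alpha)=i}\alpha^*\alpha$ ($\alpha\in Q_1$). For an arbitrary weight $v$, ${}^v\Lambda(Q)=k[z]\overline Q/(\rho_i-v_ize_i\mid i\in Q_0)$, where $k[z]\overline Q=k[z]\otimes_kk\overline Q$. If all $v_i\ne0$, this is isomorphic to $k\overline Q/(a\varrho-\varrho a\mid a\in\overline Q_1)$ with $\varrho=\sum_iv_i^{-1}\rho_i$ ($z$ corresponding to $\varrho$). *)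

(* Defs.v *)
From HB Require Import structures.
From mathcomp Require Import all_boot all_algebra.
From mathcomp Require Import finmap.
From mathcomp.multinomials Require Import monalg.
From mathcomp Require Import boolp.

Set Implicit Arguments.
Unset Strict Implicit.
Unset Printing Implicit Defensive.

Import GRing.Theory.
Local Open Scope ring_scope.
Local Open Scope quotient_scope.

Record quiver := Quiver {
  vertex : finType;
  arrow : finType;
  atail : arrow -> vertex;
  ahead : arrow -> vertex
}.

(* [inl a] is the arrow [a] of [Q], [inr a] is its reverse [a^*]. *)
Definition double_quiver (Q : quiver) : quiver :=
  @Quiver (vertex Q) (arrow Q + arrow Q)%type
    (fun b => match b with inl a => atail a | inr a => ahead a end)
    (fun b => match b with inl a => ahead a | inr a => atail a end).

Definition nedges (Q : quiver) (x y : vertex Q) : nat :=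
  #|[set a : arrow Q | ((atail a == x) && (ahead a == y))
                       || ((atail a == y) && (ahead a == x))]|.

Definition linear_edge : rel nat := [rel i j | j == i.+1].

(* The line 0 - 1 - ... - (n-2), with the extra vertex n-1 joined to b. *)
Definition branch_edge (n b : nat) : rel nat :=
  [rel i j | if j.+1 == n then i == b else j == i.+1].

(* The vertices are the i < n; each edge is listed in one direction only. *)
Variant dynkin_graph : nat -> rel nat -> Prop :=
| DynkinA n of (0 < n)%N : dynkin_graph n linear_edge
| DynkinD n of (4 <= n)%N : dynkin_graph n (branch_edge n (n - 3))
| DynkinE n of (6 <= n <= 8)%N : dynkin_graph n (branch_edge n 2).

Definition dynkin (Q : quiver) : Prop :=
  exists n (e : rel nat), dynkin_graph n e /\
  exists2 f : vertex Q -> 'I_n, bijective f &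
    forall x y : vertex Q, nedges x y = (e (f x) (f y) || e (f y) (f x)) :> nat.

Section Paths.
Variable Q : quiver.

Fixpoint walk (i : vertex Q) (s : seq (arrow Q)) : bool :=
  if s is a :: s' then (atail a == i) && walk (ahead a) s' else true.

(* A path is its starting vertex with the arrows in the order in which they
   are traversed, so that composition reads from left to right. *)
Record qpath : Type := QPath {
  pval : vertex Q * seq (arrow Q);
  _ : walk pval.1 pval.2
}.
HB.instance Definition _ := [isSub for pval].
HB.instance Definition _ := [Choice of qpath by <:].

Definition psrc (p : qpath) : vertex Q := (pval p).1.
Definition pseq (p : qpath) : seq (arrow Q) := (pval p).2.
Definition ptgt (p : qpath) : vertex Q := last (psrc p) (map (@ahead Q) (pseq p)).

Definition ptriv (i : vertex Q) : qpath := @QPath (i, [::]) isT.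

Lemma walk1 (a : arrow Q) : walk (atail a) [:: a].
Proof. by rewrite /= eqxx. Qed.
Definition parrow (a : arrow Q) : qpath := @QPath (atail a, [:: a]) (walk1 a).

Lemma walk_cat i s t :
  walk i (s ++ t) = walk i s && walk (last i (map (@ahead Q) s)) t.
Proof. by elim: s i => //= a s IH i; rewrite IH andbA. Qed.

Definition pcomp (p q : qpath) : option qpath :=
  if ptgt p == psrc q then insub (psrc p, pseq p ++ pseq q) else None.

Lemma pcompP p q r : pcomp p q = Some r <->
  [/\ ptgt p = psrc q, psrc r = psrc p & pseq r = pseq p ++ pseq q].
Proof.
rewrite /pcomp; case: eqP => [e|ne]; last by split=> // -[].
have w : walk (psrc p) (pseq p ++ pseq q).
  by rewrite walk_cat (valP p) -/(ptgt p) e; exact: (valP q).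
rewrite (insubT (fun p => walk p.1 p.2) (x := (psrc p, pseq p ++ pseq q)) w).
split=> [[<-]|[_ e1 e2]]; first by [].
congr Some; apply: val_inj => /=.
by move: e1 e2; rewrite /psrc /pseq; case: r => -[? ?] /= _ -> ->.
Qed.

End Paths.
Arguments ptriv {Q} i.
Arguments parrow {Q} a.

(* The path algebra over a commutative ring of coefficients: finitely
   supported functions on paths, with the bilinear extension of composition.
   It is not declared as an [algType], since those are nonzero rings and the
   vertex set may be empty. *)
Definition pathalg (R : comNzRingType) (Q : quiver) : Type := {malg R[qpath Q]}.

HB.instance Definition _ (R : comNzRingType) (Q : quiver) :=
  GRing.Zmodule.copy (pathalg R Q) {malg R[qpath Q]}.

(* The operations are locked: failed conversions between unfolded [malg] terms
   do not terminate in practice. *)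
HB.lock Definition pscale (R : comNzRingType) (Q : quiver) (c : R)
  (x : pathalg R Q) : pathalg R Q := c *: (x : {malg R[qpath Q]}).

Section PathModule.
Variables (R : comNzRingType) (Q : quiver).
Local Notation pscale := (@pscale R Q).

Let pscaleA a b v : pscale a (pscale b v) = pscale (a * b) v.
Proof. by rewrite pscale.unlock scalerA. Qed.
Let pscale1 : left_id 1 pscale.
Proof. by move=> x; rewrite pscale.unlock scale1r. Qed.
Let pscaleDr : right_distributive pscale +%R.
Proof. by move=> c x y; rewrite pscale.unlock; exact: scalerDr. Qed.
Let pscaleDl x : {morph pscale^~ x : a b / a + b}.
Proof. by move=> a b; rewrite pscale.unlock; exact: scalerDl. Qed.
HB.instance Definition _ := GRing.Zmodule_isLmodule.Build R (pathalg R Q)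
  pscaleA pscale1 pscaleDr pscaleDl.

Lemma pathalg_scaleE (c : R) (x : pathalg R Q) :
  c *: x = c *: (x : {malg R[qpath Q]}).
Proof. by rewrite -[LHS]/(pscale c x) pscale.unlock. Qed.
Lemma pcoeffZ (c : R) (x : pathalg R Q) p : (c *: x)@_p = c * x@_p.
Proof. by rewrite pathalg_scaleE mcoeffZ. Qed.
End PathModule.

HB.lock Definition pbasis (R : comNzRingType) (Q : quiver) (p : qpath Q) :
  pathalg R Q := << p >>.
Arguments pbasis {R Q} p.

Definition pbmul (R : comNzRingType) (Q : quiver) (p q : qpath Q) :
  pathalg R Q := if pcomp p q is Some r then pbasis r else 0.

HB.lock Definition pmul (R : comNzRingType) (Q : quiver) (x y : pathalg R Q) :
  pathalg R Q :=
  \sum_(p <- msupp x) \sum_(q <- msupp y) (x@_p * y@_q) *: pbmul R p q.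
Arguments pmul {R Q} x y.

HB.lock Definition pone (R : comNzRingType) (Q : quiver) : pathalg R Q :=
  \sum_(i : vertex Q) pbasis (ptriv i).
Arguments pone {R Q}.

Section PathAlgebra.
Variables (R : comNzRingType) (Q : quiver).
Local Notation A := (pathalg R Q).
Local Notation pbasis := (@pbasis R Q).
Local Notation pbmul := (@pbmul R Q).
Local Notation pmul := (@pmul R Q).

Let lift (f : qpath Q -> A) (x : A) : A := \sum_(p <- msupp x) x@_p *: f p.

Let liftw f (d : {fset qpath Q}) (x : A) : (msupp x `<=` d)%fset ->
  lift f x = \sum_(p <- d) x@_p *: f p.
Proof.
move=> le; rewrite /lift (big_fset_incl _ le) // => p _ np.
by rewrite mcoeff_outdom // scale0r.
Qed.

Let lift_lin f : linear (lift f).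
Proof.
move=> c x y; set d := (msupp x `|` msupp y)%fset.
have lx : (msupp x `<=` d)%fset by apply: fsubsetUl.
have ly : (msupp y `<=` d)%fset by apply: fsubsetUr.
have lxy : (msupp (c *: x + y) `<=` d)%fset.
  apply: fsubset_trans (msuppD_le _ _) _; rewrite pathalg_scaleE fsubUset ly andbT.
  exact: fsubset_trans (msuppZ_le _ _) lx.
rewrite (liftw _ lx) (liftw _ ly) (liftw _ lxy) scaler_sumr -big_split /=.
by apply: eq_bigr => p _; rewrite mcoeffD pcoeffZ scalerDl scalerA.
Qed.
HB.instance Definition _ f :=
  GRing.isLinear.Build R A A *:%R (lift f) (lift_lin f).

Let lift_basis f p : lift f (pbasis p) = f p.
Proof.
rewrite /lift pbasis.unlock msuppU oner_eq0 big_seq_fset1 mcoeffUU; exact: scale1r.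
Qed.

Lemma pbasisE (x : A) : x = \sum_(p <- msupp x) x@_p *: pbasis p.
Proof.
rewrite {1}[x]monalgE; apply: eq_bigr => p _; apply/malgP => q.
by rewrite mcoeffU pbasis.unlock pcoeffZ mcoeffU mulrnAr mulr1.
Qed.

Let lin_ext (f g : A -> A) : linear f -> linear g ->
  (forall p, f (pbasis p) = g (pbasis p)) -> forall x, f x = g x.
Proof.
move=> lf lg h x; rewrite [x]pbasisE.
pose fl := GRing.isLinear.Build R A A *:%R f lf.
pose gl := GRing.isLinear.Build R A A *:%R g lg.
pose F : {linear A -> A} := HB.pack f fl.
pose G : {linear A -> A} := HB.pack g gl.
rewrite -[f]/(F : A -> A) -[g]/(G : A -> A) !linear_sum.
by apply: eq_bigr => p _; rewrite !linearZ /= h.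
Qed.

Let pmulE x y : pmul x y = lift (fun p => lift (pbmul p) y) x.
Proof.
rewrite pmul.unlock /lift; apply: eq_bigr => p _; rewrite scaler_sumr.
by apply: eq_bigr => q _; rewrite scalerA.
Qed.

Let pmulr_lin x : linear (pmul x).
Proof.
move=> c y z; rewrite !pmulE /lift scaler_sumr -big_split /=.
apply: eq_bigr => p _; rewrite -!/(lift _ _) linearP scalerDr !scalerA.
by rewrite mulrC.
Qed.
Let pmull_lin y : linear (pmul^~ y).
Proof. by move=> c x z; rewrite /= !pmulE linearP. Qed.

Let pmul0x x : pmul 0 x = 0.
Proof. by have := pmull_lin x (-1) 0 0; rewrite !scaleN1r !addNr. Qed.
Let pmulx0 x : pmul x 0 = 0.
Proof. by have := pmulr_lin x (-1) 0 0; rewrite !scaleN1r !addNr. Qed.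

Lemma pmul_basis p q : pmul (pbasis p) (pbasis q) = pbmul p q.
Proof. by rewrite pmulE !lift_basis. Qed.

Let pbmulA p q r :
  pmul (pbmul p q) (pbasis r) = pmul (pbasis p) (pbmul q r).
Proof.
rewrite /pbmul.
case E1: (pcomp p q) => [pq|]; case E2: (pcomp q r) => [qr|].
- rewrite (pmul_basis pq) (pmul_basis p) /pbmul; congr (if _ is Some _ then _ else _).
  have /pcompP[e1 e2 e3] := E1; have /pcompP[e4 e5 e6] := E2.
  have tq : ptgt pq = psrc r.
    by rewrite -e4 /ptgt e2 e3 map_cat last_cat -/(ptgt p) e1.
  rewrite /pcomp tq eqxx e5 e1 eqxx.
  by rewrite e2 e3 e6 catA.
- rewrite (pmul_basis pq) pmulx0 /pbmul.
  have /pcompP[e1 e2 e3] := E1.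
  case E3: (pcomp pq r) => [s|] //.
  have /pcompP[e4 _ _] := E3.
  have tq : ptgt q = psrc r.
    by rewrite -e4 /ptgt e2 e3 map_cat last_cat -/(ptgt p) e1.
  move: E2; rewrite /pcomp tq eqxx insubT //=.
  by rewrite walk_cat (valP q) -/(ptgt q) tq; exact: (valP r).
- rewrite (pmul_basis p) pmul0x /pbmul.
  have /pcompP[e1 e2 e3] := E2.
  case E3: (pcomp p qr) => [s|] //.
  have /pcompP[e4 _ _] := E3.
  have tp : ptgt p = psrc q by rewrite e4.
  move: E1; rewrite /pcomp tp eqxx insubT //=.
  by rewrite walk_cat (valP p) -/(ptgt p) tp; exact: (valP q).
- by rewrite pmul0x pmulx0.
Qed.

Let pmulA : associative pmul.
Proof.
move=> x y z.
have lcomp (f g : A -> A) : linear f -> linear g -> linear (f \o g).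
  by move=> lf lg c a b; rewrite /comp lg lf.
apply: (lin_ext (f := pmul^~ (pmul y z)) (g := pmul^~ z \o pmul^~ y)) x => [||p].
- exact: pmull_lin.
- exact: lcomp (pmull_lin z) (pmull_lin y).
apply: (lin_ext (f := pmul (pbasis p) \o pmul^~ z)
                (g := pmul^~ z \o pmul (pbasis p))) y => [||q].
- exact: lcomp (pmulr_lin _) (pmull_lin _).
- exact: lcomp (pmull_lin _) (pmulr_lin _).
apply: (lin_ext (f := pmul (pbasis p) \o pmul (pbasis q))
                (g := pmul (pmul (pbasis p) (pbasis q)))) z => [||r].
- exact: lcomp (pmulr_lin _) (pmulr_lin _).
- exact: pmulr_lin.
by rewrite /comp (pmul_basis p q) (pmul_basis q r) pbmulA.
Qed.

Let pcomp1p i (p : qpath Q) :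
  pcomp (ptriv i) p = if i == psrc p then Some p else None.
Proof.
case: eqP => [e|ne]; first by apply/pcompP; split.
by rewrite /pcomp [ptgt _]/=; case: eqP.
Qed.
Let pcompp1 i (p : qpath Q) :
  pcomp p (ptriv i) = if i == ptgt p then Some p else None.
Proof.
case: eqP => [e|ne]; first by apply/pcompP; split=> //; rewrite cats0.
by rewrite /pcomp; case: eqP => // e; case: ne.
Qed.

Let pmulDl : left_distributive pmul +%R.
Proof. by move=> x y z; have := pmull_lin z 1 x y; rewrite !scale1r. Qed.
Let pmulDr : right_distributive pmul +%R.
Proof. by move=> x y z; have := pmulr_lin x 1 y z; rewrite !scale1r. Qed.

Let pmul1x : left_id pone pmul.
Proof.
apply: lin_ext => [||p]; [exact: pmulr_lin | by [] |].
rewrite pone.unlock (big_morph (pmul^~ (pbasis p)) (fun x y => pmulDl x y _) (pmul0x _)).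
rewrite (bigD1 (psrc p)) //= big1 => [|i ne].
  by rewrite addr0 pmul_basis /pbmul pcomp1p eqxx.
by rewrite pmul_basis /pbmul pcomp1p (negPf ne).
Qed.
Let pmulx1 : right_id pone pmul.
Proof.
apply: lin_ext => [||p]; [exact: pmull_lin | by [] |].
rewrite pone.unlock (big_morph (pmul (pbasis p)) (pmulDr _) (pmulx0 _)).
rewrite (bigD1 (ptgt p)) //= big1 => [|i ne].
  by rewrite addr0 pmul_basis /pbmul pcompp1 eqxx.
by rewrite pmul_basis /pbmul pcompp1 (negPf ne).
Qed.

Let pmulZl c x y : pmul (c *: x) y = c *: pmul x y.
Proof. by rewrite !pmulE linearZ. Qed.
Let pmulZr c x y : pmul x (c *: y) = c *: pmul x y.
Proof.
rewrite !pmulE /lift scaler_sumr; apply: eq_bigr => p _.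
by rewrite -!/(lift _ _) linearZ !scalerA mulrC.
Qed.

HB.instance Definition _ := GRing.Zmodule_isPzRing.Build A
  pmulA pmul1x pmulx1 pmulDl pmulDr.

Lemma pathalg_scalerAl (c : R) (x y : A) : c *: (x * y) = (c *: x) * y.
Proof. exact: esym (pmulZl c x y). Qed.
Lemma pathalg_scalerAr (c : R) (x y : A) : c *: (x * y) = x * (c *: y).
Proof. exact: esym (pmulZr c x y). Qed.

Definition idem (i : vertex Q) : A := pbasis (ptriv i).
Definition arr (a : arrow Q) : A := pbasis (parrow a).

End PathAlgebra.
Arguments idem {R Q} i.
Arguments arr {R Q} a.

Section TwoSidedIdeal.
Variables (A : pzRingType) (S : A -> Prop).

Inductive ideal_gen : A -> Prop :=
| ideal_gen_in x of S x : ideal_gen x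
| ideal_gen0 : ideal_gen 0
| ideal_genD x y of ideal_gen x & ideal_gen y : ideal_gen (x + y)
| ideal_genMl a x of ideal_gen x : ideal_gen (a * x)
| ideal_genMr a x of ideal_gen x : ideal_gen (x * a).

Definition idealb : {pred A} := fun x => `[< ideal_gen x >].

Let idealb_zmod : zmod_closed idealb.
Proof.
split; first exact/asboolP/ideal_gen0.
move=> x y /asboolP ix /asboolP iy; apply/asboolP.
by rewrite -mulN1r; apply: ideal_genD => //; apply: ideal_genMl.
Qed.
HB.instance Definition _ := GRing.isZmodClosed.Build A idealb idealb_zmod.

Definition quo : Type := {ideal_quot idealb}.
HB.instance Definition _ := GRing.Zmodule.on quo.
HB.instance Definition _ := EqQuotient.on quo.

Definition qpi (x : A) : quo := \pi_{ideal_quot idealb} x.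

Lemma qpi_eq x y : qpi x = qpi y <-> ideal_gen (x - y).
Proof.
split=> [/eqP|i]; last apply/eqP; rewrite -?Quotient.idealrBE.
  by move/asboolP.
exact/asboolP.
Qed.

Let qmul (x y : quo) : quo := qpi (repr x * repr y).
Let qone : quo := qpi 1.

Let qpiK (x : quo) : qpi (repr x) = x. Proof. exact: reprK. Qed.
Let repr_ideal x : ideal_gen (repr (qpi x) - x).
Proof. by apply/qpi_eq; rewrite qpiK. Qed.

Let qpi_is_zmod : zmod_morphism qpi.
Proof. by move=> x y; rewrite /qpi raddfB. Qed.
HB.instance Definition _ := GRing.isZmodMorphism.Build A quo qpi qpi_is_zmod.

Let qpi_mul x y : qpi (x * y) = qmul (qpi x) (qpi y).
Proof.
apply/esym/qpi_eq; set x' := repr _; set y' := repr _.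
have -> : x' * y' - x * y = (x' - x) * y' + x * (y' - y).
  by rewrite mulrBl mulrBr addrA subrK.
by apply: ideal_genD; [apply: ideal_genMr | apply: ideal_genMl];
   apply: repr_ideal.
Qed.

Let qmulA : associative qmul.
Proof.
by move=> x y z; rewrite -[x]qpiK -[y]qpiK -[z]qpiK -!qpi_mul mulrA.
Qed.
Let qmul1x : left_id qone qmul.
Proof. by move=> x; rewrite -[x]qpiK -qpi_mul mul1r. Qed.
Let qmulx1 : right_id qone qmul.
Proof. by move=> x; rewrite -[x]qpiK -qpi_mul mulr1. Qed.
Let qmulDl : left_distributive qmul +%R.
Proof.
move=> x y z; rewrite -[x]qpiK -[y]qpiK -[z]qpiK.
by rewrite -raddfD -!qpi_mul mulrDl raddfD.
Qed.
Let qmulDr : right_distributive qmul +%R.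
Proof.
move=> x y z; rewrite -[x]qpiK -[y]qpiK -[z]qpiK.
by rewrite -raddfD -!qpi_mul mulrDr raddfD.
Qed.
HB.instance Definition _ := GRing.Zmodule_isPzRing.Build quo
  qmulA qmul1x qmulx1 qmulDl qmulDr.

Let qpi_is_monoid : monoid_morphism qpi.
Proof. by split=> // x y; rewrite qpi_mul. Qed.
HB.instance Definition _ := GRing.isMonoidMorphism.Build A quo qpi
  qpi_is_monoid.

Lemma qpiM x y : qpi (x * y) = qpi x * qpi y. Proof. exact: rmorphM. Qed.

End TwoSidedIdeal.

(* [k[z]\bar Q = k[z] (x) k\bar Q] is the path algebra of [double_quiver Q] with
   coefficients in [{poly k}], where [z] is ['X]. *)
Section QuiverHeisenberg.
Variables (k : fieldType) (Q : quiver) (v : {ffun vertex Q -> k}).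
Local Notation kzQ := (pathalg {poly k} (double_quiver Q)).

Definition orig (a : arrow Q) : kzQ := arr (inl a : arrow (double_quiver Q)).
Definition star (a : arrow Q) : kzQ := arr (inr a : arrow (double_quiver Q)).

Definition rho (i : vertex Q) : kzQ :=
  \sum_(a : arrow Q | atail a == i) orig a * star a
  - \sum_(a : arrow Q | ahead a == i) star a * orig a.

Definition heisenberg_rel (x : kzQ) : Prop :=
  exists i : vertex Q, x = rho i - (v i *: 'X) *: idem (i : vertex (double_quiver Q)).

Definition heisenberg : Type := quo heisenberg_rel.
HB.instance Definition _ := GRing.PzRing.on heisenberg.

Let hscale (c : k) (x : heisenberg) : heisenberg :=
  qpi heisenberg_rel (c%:P *: (1 : kzQ)) * x.

Let hscaleA a b x : hscale a (hscale b x) = hscale (a * b) x.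
Proof.
rewrite /hscale mulrA -rmorphM -pathalg_scalerAl mul1r scalerA.
by rewrite -polyCM.
Qed.
Let hscale1 : left_id 1 hscale.
Proof. by move=> x; rewrite /hscale scale1r rmorph1 mul1r. Qed.
Let hscaleDr : right_distributive hscale +%R.
Proof. by move=> c x y; rewrite /hscale mulrDr. Qed.
Let hscaleDl x : {morph hscale^~ x : a b / a + b}.
Proof. by move=> a b; rewrite /hscale polyCD scalerDl rmorphD mulrDl. Qed.
HB.instance Definition _ := GRing.Zmodule_isLmodule.Build k heisenberg
  hscaleA hscale1 hscaleDr hscaleDl.

Lemma heisenberg_scaleE (c : k) (x : kzQ) :
  c *: (qpi heisenberg_rel x : heisenberg) = qpi heisenberg_rel (c%:P *: x).
Proof.
by rewrite -[x in RHS]mul1r pathalg_scalerAl rmorphM.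
Qed.

End QuiverHeisenberg.

Definition finite_dim (k : fieldType) (V : lmodType k) : Prop :=
  exists s : seq V, forall x : V,
  exists c : nat -> k, x = \sum_(j < size s) c j *: s`_j.

(* [(f \o g)%VF] applies [g] first, so [modactM] makes [N] a left module; [e_i N]
   is then [limg (modact N (idem i))]. *)
Record kQmodule (k : fieldType) (Q : quiver) := KQModule {
  carrier :> vectType k;
  modact : {linear pathalg k Q -> 'End(carrier)};
  modact1 : modact 1 = \1%VF;
  modactM : forall a b, modact (a * b) = (modact a \o modact b)%VF
}.

Section Regular.
Variables (k : fieldType) (Q : quiver).

Definition submodule (N : kQmodule k Q) (U : {vspace N}) : Prop :=
  forall a : pathalg k Q, (modact N a @: U <= U)%VS.

Definition indecomposable (N : kQmodule k Q) : Prop :=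
  (fullv : {vspace N}) <> 0%VS /\
  forall U W : {vspace N}, submodule U -> submodule W ->
    (U + W)%VS = fullv -> (U :&: W)%VS = 0%VS -> U = 0%VS \/ W = 0%VS.

Definition regular_weight (v : {ffun vertex Q -> k}) : Prop :=
  forall N : kQmodule k Q, indecomposable N ->
    \sum_(i : vertex Q) v i * (\dim (limg (modact N (idem i))))%:R != 0.

End Regular.

(* Main.v *)
Require Import Defs.
From HB Require Import structures.
From mathcomp Require Import all_boot all_order all_algebra.
From mathcomp Require Import boolp zify ring lra finmap.
From mathcomp.multinomials Require Import monalg.

Set Implicit Arguments.
Unset Strict Implicit.
Unset Printing Implicit Defensive.

Import GRing.Theory.
Local Open Scope ring_scope.

(* Regular implies finite-dimensional.  For a module [M] over the preprojective
   algebra [Pi] with dimension vector [d], the image of [H |-> (a H - H a)_a], with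
   [H] in [prod_i End (e_i M)] and [a] over the arrows of the double quiver, is
   isotropic for a symplectic trace form, whence [q d <= dim End_Pi M] for the
   Tits form [q].  Applied to the cyclic modules
   [e_i Pi / (degree >= L)] this reads [q d <= d i]; as [q] is positive definite,
   their dimensions are bounded, so [Pi] is finite-dimensional and the Heisenberg
   algebra [Lambda] is finitely generated over [k[z]].  An indecomposable
   kQ-summand [N] of [Lambda / (z - 1)] satisfies [sum_i v i dim (e_i N) = 0]
   (trace of the relations), so regularity gives [Lambda = (z - 1) Lambda], and
   Cayley-Hamilton concludes.
   Conversely, let [N] be indecomposable with [sum_i v i dim (e_i N) = 0].  By
   Ringel's argument [N] is a rigid brick, and positivity of [q] gives
   [End N = k].  By trace duality [N] then lifts to a module over
   [Lambda / (z - 1)], and [k[z] (x) N] is a [Lambda]-module without [z]-torsion,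
   which excludes finite dimension. *)

(** The Tits form enters as an Euler characteristic: for a representation of Q with dimension vector
    d, the map H |-> (a H - H a)_a goes from a space of dimension sum_i (d i)^2 to one of dimension
    sum_a d (tail a) d (head a), with kernel End and cokernel Ext^1. Over the double quiver the
    target doubles in dimension and isotropy halves the bound on the image, which leads back to q of
    Q itself. The field is arbitrary, so End N is at first only a division ring, while the trace
    duality needs it to be k. This is settled by arithmetic: with m = dim End N, rigidity gives q d
    = m, and m divides every d i, so m^2 divides m. The value z = 1 serves because it turns the
    relations into rho_i = v_i e_i, whose traces see the weight. A finitely generated k[z]-module
    with zero fibre at this one point is torsion, hence finite-dimensional; conversely a module over
    the fibre spreads over k[z] when every a^* is multiplied by z. *)

Lemma linear_fun0 (R : pzRingType) (U V : lmodType R) (f : U -> V) : linear f -> f 0 = 0.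
Proof. by move=> lf; have := lf (-1) 0 0; rewrite scaler0 addr0 scaleN1r addNr. Qed.

Lemma linear_mxE (k : fieldType) m p (f : 'rV[k]_m -> 'rV[k]_p) :
  linear f -> exists D : 'M_(m, p), forall u, u *m D = f u.
Proof.
move=> lf.
pose fl := GRing.isLinear.Build k 'rV[k]_m 'rV[k]_p *:%R f lf.
pose F : {linear 'rV[k]_m -> 'rV[k]_p} := HB.pack f fl.
by exists (lin1_mx F) => u; rewrite mul_rV_lin1.
Qed.

(** * Representations by matrices and their cochains *)

Section Idempotents.
Variables (k : fieldType) (n : nat).
Implicit Types E F : 'M[k]_n.

Lemma idem_factor E : E *m E = E ->
  {cr : 'M_(n, \rank E) * 'M_(\rank E, n) | cr.1 *m cr.2 = E & cr.2 *m cr.1 = 1%:M}.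
Proof.
move=> EE; exists (col_base E, row_base E); rewrite /= ?mulmx_base //.
have := row_base_free E; have := col_base_full E; have := mulmx_base E.
move: (col_base E) (row_base E) => c r ecr fc fr.
apply: (row_free_inj fr); apply: (row_full_inj fc).
by rewrite mul1mx !mulmxA ecr -mulmxA ecr EE.
Qed.

Lemma idem_mxtrace E : E *m E = E -> \tr E = (\rank E)%:R.
Proof.
by case/idem_factor=> -[c r] /= e rc; rewrite -[in LHS]e mxtrace_mulC rc mxtrace1.
Qed.

(** Rank factorizations of the idempotents identify each corner E j M_n F j with full matrices of
    size [\rank (E j)] by [\rank (F j)]. Families of corner elements thus become row vectors, and
    dimensions can be counted as matrix ranks. *)
Lemma idem_corner_coord (J : finType) (E F : J -> 'M[k]_n) :
  (forall j, E j *m E j = E j) -> (forall j, F j *m F j = F j) ->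
  exists2 W : 'rV[k]_(\sum_j \rank (E j) * \rank (F j)) -> J -> 'M[k]_n,
    (forall j, linear (W^~ j)) & 
    [/\ forall u j, E j *m W u j *m F j = W u j,
        forall u, (forall j, W u j = 0) -> u = 0
      & forall g, (forall j, E j *m g j *m F j = g j) ->
          exists u, forall j, W u j = g j].
Proof.
move=> EE FF.
pose S := {j : J & ('I_(\rank (E j)) * 'I_(\rank (F j)))%type}.
have cS : #|{: S}| = (\sum_j \rank (E j) * \rank (F j))%N.
  rewrite card_tagged sumnE big_map big_enum /=.
  by apply: eq_bigr => j _; rewrite card_prod !card_ord.
rewrite -cS.
pose M (u : 'rV[k]_#|{: S}|) j : 'M_(\rank (E j), \rank (F j)) :=
  \matrix_(p, q) u 0 (enum_rank (Tagged _ (p, q) : S)).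
pose c j := (s2val (idem_factor (EE j))).1; pose r j := (s2val (idem_factor (EE j))).2.
pose c' j := (s2val (idem_factor (FF j))).1; pose r' j := (s2val (idem_factor (FF j))).2.
have ecr j : c j *m r j = E j := s2valP (idem_factor (EE j)).
have erc j : r j *m c j = 1%:M := s2valP' (idem_factor (EE j)).
have ecr' j : c' j *m r' j = F j := s2valP (idem_factor (FF j)).
have erc' j : r' j *m c' j = 1%:M := s2valP' (idem_factor (FF j)).
clearbody c r c' r'.
have cE j : E j *m c j = c j.
  by rewrite -[X in X *m c j]ecr -mulmxA erc mulmx1.
have rF j : r' j *m F j = r' j.
  by rewrite -[X in _ *m X]ecr' mulmxA erc' mul1mx.
pose W u j := c j *m M u j *m r' j.
have MK g : exists u, forall j, M u j = g j.
  exists (\row_i g (tag (enum_val i)) (tagged (enum_val i)).1 (tagged (enum_val i)).2).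
  by move=> j; apply/matrixP => p q; rewrite !mxE enum_rankK.
have MZ e u v j : M (e *: u + v) j = e *: M u j + M v j.
  by apply/matrixP => p q; rewrite !mxE.
exists W => [j e u v|]; first by rewrite /W MZ mulmxDr mulmxDl -scalemxAr -scalemxAl.
have WM u j : r j *m W u j *m c' j = M u j.
  by rewrite /W !mulmxA erc mul1mx -mulmxA erc' mulmx1.
split=> [u j|u W0|g Hg].
- by rewrite /W !mulmxA cE -!mulmxA rF.
- apply/rowP => i; rewrite mxE -(enum_valK i).
  case: (enum_val i) => j [p q].
  have /matrixP/(_ p q) := WM u j.
  by rewrite W0 mulmx0 mul0mx !mxE => <-.
have [u Hu] := MK (fun j => r j *m g j *m c' j).
exists u => j; rewrite /W Hu !mulmxA ecr -!mulmxA ecr' mulmxA.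
exact: Hg.
Qed.

End Idempotents.

(** All vertex spaces sit in one R^n, cut out by orthogonal idempotents, so that no matrix size
    depends on a vertex. Matrices act on row vectors from the right, hence a path read from left to
    right acts by the product of its matrices in the same order. *)
Record qrep (R : comNzRingType) (Q : quiver) n (E : vertex Q -> 'M[R]_n)
    (A : arrow Q -> 'M[R]_n) : Prop := QRep {
  qrepEE : forall i, E i *m E i = E i;
  qrepE0 : forall i j, i != j -> E i *m E j = 0;
  qrepE1 : \sum_i E i = 1%:M;
  qrep_tail : forall a, E (atail a) *m A a = A a;
  qrep_head : forall a, A a *m E (ahead a) = A a }.

Definition qhom (R : comNzRingType) (Q : quiver) m n
    (E : vertex Q -> 'M[R]_m) (A : arrow Q -> 'M[R]_m)
    (E' : vertex Q -> 'M[R]_n) (A' : arrow Q -> 'M[R]_n) (H : 'M[R]_(m, n)) :=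
  (forall i, E i *m H = H *m E' i) /\ (forall a, A a *m H = H *m A' a).

Section Cochains.
Variables (k : fieldType) (Q : quiver) (n : nat).
Variables (E : vertex Q -> 'M[k]_n) (A : arrow Q -> 'M[k]_n).
Hypothesis EA : qrep E A.
Let d i := \rank (E i).
Local Notation N0 := (\sum_i d i * d i)%N.
Local Notation N1 := (\sum_a d (atail a) * d (ahead a))%N.

Definition graded (H : 'M[k]_n) := forall i, E i *m H = H *m E i.
Definition arrow_graded (g : arrow Q -> 'M[k]_n) :=
  forall a, E (atail a) *m g a *m E (ahead a) = g a.
(** The differential from [graded] matrices to [arrow_graded] families; its kernel is the
    endomorphism ring and its cokernel is Ext^1 of the representation with itself. *)
Definition cobound (H : 'M[k]_n) (a : arrow Q) := A a *m H - H *m A a.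

Lemma cobound_lin a : linear (cobound^~ a).
Proof.
move=> c X Y; rewrite /cobound mulmxDr mulmxDl -scalemxAr -scalemxAl.
by rewrite scalerBr opprD addrACA.
Qed.

Lemma cobound_graded H : graded H -> arrow_graded (cobound H).
Proof.
move=> gH a; rewrite /cobound mulmxBr mulmxBl !mulmxA (qrep_tail EA).
rewrite -(mulmxA (A a)) -gH mulmxA (qrep_head EA) gH.
by rewrite -(mulmxA H) (qrep_tail EA) -(mulmxA H) (qrep_head EA).
Qed.

Lemma cobound_eq0 H : (forall a, cobound H a = 0) -> forall a, A a *m H = H *m A a.
Proof. by move=> h a; apply/eqP; rewrite -subr_eq0 [_ - _]h. Qed.

(** In coordinates the coboundary is a single matrix [D], so that Hom and Ext^1 are compared by rank
    and nullity. The difference of its two sizes is the Tits form of the quiver at the vector of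
    ranks. *)
Lemma cochain_coord :
  exists (Z : 'rV[k]_N0 -> 'M[k]_n) (W : 'rV[k]_N1 -> arrow Q -> 'M[k]_n) (D : 'M[k]_(N0, N1)),
  [/\ [/\ linear Z, forall h, graded (Z h), forall h, Z h = 0 -> h = 0
       & forall H, graded H -> exists h, Z h = H],
     [/\ forall a, linear (W^~ a), forall u, arrow_graded (W u),
       forall u, (forall a, W u a = 0) -> u = 0
       & forall g, arrow_graded g -> exists u, forall a, W u a = g a]
   & forall h a, W (h *m D) a = cobound (Z h) a].
Proof.
have [W0 lW0 [gW0 iW0 sW0]] := idem_corner_coord (qrepEE EA) (qrepEE EA).
have [W lW [gW iW sW]] :=
  idem_corner_coord (fun a => qrepEE EA (atail a)) (fun a => qrepEE EA (ahead a)).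
pose Z h := \sum_i W0 h i.
have EZ h i : E i *m Z h = W0 h i.
  rewrite mulmx_sumr (bigD1 i) //= -gW0 !mulmxA (qrepEE EA) big1 ?addr0 // => j ji.
  by rewrite -gW0 !mulmxA (qrepE0 EA) ?mul0mx // eq_sym.
have ZE h i : Z h *m E i = W0 h i.
  rewrite mulmx_suml (bigD1 i) //= -gW0 -!mulmxA (qrepEE EA) big1 ?addr0 // => j ji.
  by rewrite -gW0 -!mulmxA (qrepE0 EA) // !mulmx0.
have lZ : linear Z.
  move=> c u w; rewrite /Z scaler_sumr -big_split; apply: eq_bigr => i _; exact: lW0.
have gZ h : graded (Z h) by move=> i; rewrite EZ ZE.
have [f Hf] : exists f, forall h a, W (f h) a = cobound (Z h) a.
  have ex h := sW _ (cobound_graded (gZ h)).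
  by exists (fun h => sval (cid (ex h))) => h a; case: cid.
have W_B u w a : W (u - w) a = W u a - W w a.
  by have := lW a (-1) w u; rewrite !scaleN1r ![- _ + _]addrC.
have lf : linear f.
  move=> c h h'; apply/eqP; rewrite -subr_eq0; apply/eqP; apply: iW => a.
  by rewrite W_B (lW a c) !Hf lZ cobound_lin subrr.
have [D HD] := linear_mxE lf.
exists Z, W, D; split; last by move=> h a; rewrite HD Hf.
  split=> // [h Z0|H gH].
    by apply: iW0 => i; rewrite -EZ Z0 mulmx0.
  have [|h Hh] := sW0 (fun i => E i *m H).
    by move=> i; rewrite -!mulmxA -gH !mulmxA !(qrepEE EA).
  exists h; rewrite /Z (eq_bigr _ (fun i _ => Hh i)) -mulmx_suml (qrepE1 EA).
  by rewrite mul1mx.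
by split.
Qed.

End Cochains.

Lemma linear_rV_sum (k : fieldType) m (f : 'rV[k]_m -> k) :
  (forall c u v, f (c *: u + v) = c * f u + f v) ->
  forall u, f u = \sum_i u 0 i * f (delta_mx 0 i).
Proof.
move=> lf u.
have f0 : f 0 = 0 by have := lf (-1) 0 0; rewrite scaler0 addr0 mulN1r addNr.
have fZ c w : f (c *: w) = c * f w by rewrite -[c *: w]addr0 lf f0 addr0.
have fD v w : f (v + w) = f v + f w by rewrite -[v in LHS]scale1r lf mul1r.
rewrite [u in LHS]row_sum_delta (big_morph f fD f0).
by apply: eq_bigr => i _; rewrite fZ.
Qed.

Lemma mxtrace_mul0 (k : fieldType) n (X : 'M[k]_n) :
  (forall Y, \tr (Y *m X) = 0) -> X = 0.
Proof.
move=> h; apply/matrixP => i j; rewrite mxE -(h (delta_mx j i)).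
rewrite /mxtrace (bigD1 j) //= big1 => [|l lj].
  rewrite mxE (bigD1 i) //= mxE !eqxx mul1r big1 ?addr0 // => l li.
  by rewrite mxE (negPf li) andbF mul0r.
by rewrite mxE big1 // => m _; rewrite mxE (negPf lj) mul0r.
Qed.

(** * The dimension bound for cyclic modules over the preprojective algebra *)

Section PreprojectiveBound.
Variables (k : fieldType) (Q : quiver) (n : nat).
Local Notation DQ := (double_quiver Q).
Variables (E : vertex DQ -> 'M[k]_n) (A : arrow DQ -> 'M[k]_n).
Hypothesis EA : qrep E A.
Hypothesis rho0 :
  \sum_(a : arrow Q) (A (inl a) *m A (inr a) - A (inr a) *m A (inl a)) = 0.
Let d i := \rank (E i).

(** The standard symplectic form on representations of the double quiver, viewed as the cotangent
    space of the representations of Q. *)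
Let pairing (g g' : arrow DQ -> 'M[k]_n) : k :=
  \sum_(a : arrow Q) (\tr (g (inl a) *m g' (inr a)) - \tr (g (inr a) *m g' (inl a))).

Let pairing_linl c g1 g2 g g' :
  (forall a, g a = c *: g1 a + g2 a) ->
  pairing g g' = c * pairing g1 g' + pairing g2 g'.
Proof.
move=> gE; rewrite /pairing mulr_sumr -big_split /=; apply: eq_bigr => a _.
rewrite !gE !mulmxDl -!scalemxAl !mxtraceD !mxtraceZ.
by rewrite opprD addrACA mulrBr.
Qed.

Let pairing_linr c g1 g2 g g' :
  (forall a, g a = c *: g1 a + g2 a) ->
  pairing g' g = c * pairing g' g1 + pairing g' g2.
Proof.
move=> gE; rewrite /pairing mulr_sumr -big_split /=; apply: eq_bigr => a _.
rewrite !gE !mulmxDr -!scalemxAr !mxtraceD !mxtraceZ.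
by rewrite opprD addrACA mulrBr.
Qed.

(* By cyclicity of the trace, the left-hand side is [\tr (rho * [H, H'])]. *)
Let pairing_cobound H H' : pairing (cobound A H) (cobound A H') = 0.
Proof.
have -> : pairing (cobound A H) (cobound A H') =
  \tr ((\sum_(a : arrow Q) (A (inl a) *m A (inr a) - A (inr a) *m A (inl a)))
    *m (H *m H' - H' *m H)).
  rewrite mulmx_suml raddf_sum; apply: eq_bigr => a _ /=.
  rewrite /cobound; move: (A (inl a)) (A (inr a)) => X Y.
  rewrite !(mulmxBl, mulmxBr) !mulmxA !raddfB /=. 
  have c1 : \tr (H *m Y *m H' *m X) = \tr (X *m H *m Y *m H').
    by rewrite mxtrace_mulC !mulmxA.
  have c2 : \tr (H *m X *m H' *m Y) = \tr (Y *m H *m X *m H').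
    by rewrite mxtrace_mulC !mulmxA.
  have c3 : \tr (X *m H *m H' *m Y) = \tr (Y *m X *m H *m H').
    by rewrite mxtrace_mulC !mulmxA.
  have c4 : \tr (Y *m H *m H' *m X) = \tr (X *m Y *m H *m H').
    by rewrite mxtrace_mulC !mulmxA.
  have c5 : \tr (H *m X *m Y *m H') = \tr (X *m Y *m H' *m H).
    by rewrite -!mulmxA mxtrace_mulC !mulmxA.
  have c6 : \tr (H *m Y *m X *m H') = \tr (Y *m X *m H' *m H).
    by rewrite -!mulmxA mxtrace_mulC !mulmxA.
  rewrite c1 c2 c3 c4 c5 c6; ring.
by rewrite rho0 mul0mx mxtrace0.
Qed.

Let pairing_nondeg g' : arrow_graded E g' ->
  (forall g, arrow_graded E g -> pairing g g' = 0) -> forall a, g' a = 0.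
Proof.
move=> gg' h.
(* Test families concentrated on one arrow: paired with [g'] they recover every trace against the
   component of [g'] at the opposite arrow. *)
pose pj (b : arrow DQ) (Y : 'M[k]_n) (a : arrow DQ) :=
  if a == b then E (atail a) *m Y *m E (ahead a) else 0.
have gpj b Y : arrow_graded E (pj b Y).
  move=> a; rewrite /pj; case: eqP => _; last by rewrite mulmx0 mul0mx.
  by rewrite !mulmxA (qrepEE EA) -!mulmxA (qrepEE EA).
case=> a; apply: mxtrace_mul0 => Y.
- have := h _ (gpj (inr a) Y); rewrite /pairing (bigD1 a) //= big1 => [|b ba].
    rewrite /pj eqxx /= mul0mx mxtrace0 sub0r addr0 => /eqP; rewrite oppr_eq0 => /eqP.
    by rewrite -!mulmxA mxtrace_mulC -(mulmxA Y) (gg' (inl a)).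
  rewrite /pj /= mul0mx mxtrace0; case: eqP => [[e]|]; first by rewrite e eqxx in ba.
  by rewrite mul0mx mxtrace0 subrr.
- have := h _ (gpj (inl a) Y); rewrite /pairing (bigD1 a) //= big1 => [|b ba].
    rewrite /pj eqxx /= mul0mx mxtrace0 subr0 addr0.
    by rewrite -!mulmxA mxtrace_mulC -(mulmxA Y) (gg' (inr a)).
  rewrite /pj /= mul0mx mxtrace0; case: eqP => [[e]|]; first by rewrite e eqxx in ba.
  by rewrite mul0mx mxtrace0 subrr.
Qed.

(** Isotropy bounds the rank of [D] by half of the dimension of its target. Its kernel consists of
    the endomorphisms, and H |-> [gen *m H] embeds it into the row space of [E i0], of dimension
    [d i0]. *)
Lemma cyclic_preprojective_bound i0 (gen : 'rV[k]_n) :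
  gen *m E i0 = gen ->
  (forall H, graded E H -> (forall a, A a *m H = H *m A a) -> gen *m H = 0 -> H = 0) ->
  (\sum_i d i * d i <= \sum_(a : arrow Q) d (atail a) * d (ahead a) + d i0)%N.
Proof.
move=> genE geninj.
have [Z [W [D [[lZ gZ iZ sZ] [lW gW iW sW] WD]]]] := cochain_coord EA.
(* [P] is the adjoint of [D] for the pairing: nondegeneracy gives rank D <= rank P, and isotropy, D
   P = 0, bounds the sum of the two ranks by the size of the middle space. *)
have [P HP] : exists P, forall u, u *m P =
    \row_i pairing (W u) (cobound A (Z (delta_mx 0 i))).
  apply: linear_mxE => c u v; apply/rowP => i; rewrite !mxE.
  exact: (pairing_linl _ (fun a => lW a c u v)).
have DP0 : D *m P = 0.
  apply/row_matrixP => i; rewrite row_mul rowE -mulmxA.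
  rewrite mulmxA HP row0; apply/rowP => j; rewrite !mxE.
  have -> : pairing (W (delta_mx 0 i *m D)) = pairing (cobound A (Z (delta_mx 0 i))).
    by congr pairing; apply/funext => a; rewrite WD.
  exact: pairing_cobound.
have rDP : (\rank D <= \rank P)%N.
  have kle : (kermx P^T <= kermx D)%MS.
    apply/rV_subP => h /sub_kermxP hP; apply/sub_kermxP.
    apply: iW => a; rewrite WD.
    apply: (pairing_nondeg (cobound_graded EA (gZ h))) => g gg.
    have [u Hu] := sW g gg.
    have -> : g = W u by apply/funext => b; rewrite Hu.
    have -> : pairing (W u) (cobound A (Z h)) = (u *m (h *m P^T)^T) 0 0.
      rewrite trmx_mul trmxK mulmxA HP !mxE.
      rewrite (linear_rV_sum (f := fun h => pairing (W u) (cobound A (Z h)))) => [|c h1 h2].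
        by apply: eq_bigr => i _; rewrite !mxE mulrC.
      by apply: pairing_linr => b; rewrite lZ cobound_lin.
    by rewrite hP trmx0 mulmx0 mxE.
  have := mxrankS kle; rewrite !mxrank_ker mxrank_tr.
  have := rank_leq_row D; have := rank_leq_col P; lia.
have [G HG] : exists G, forall h, h *m G = gen *m Z h.
  by apply: linear_mxE => c u v; rewrite lZ mulmxDr -scalemxAr.
have kG : (\rank (kermx D) <= d i0)%N.
  rewrite -(mxrank_mul_ker (kermx D) G).
  have -> : (kermx D :&: kermx G)%MS = 0.
    apply/eqP; rewrite -submx0; apply/rV_subP => h.
    rewrite sub_capmx => /andP[/sub_kermxP hD /sub_kermxP]; rewrite HG => hG.
    rewrite (iZ h) ?sub0mx //; apply: geninj hG => // a.
    by apply: cobound_eq0 => b; rewrite -WD hD; exact: linear_fun0 (lW b).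
  rewrite mxrank0 addn0; apply: mxrankS; apply/rV_subP => w /submxP[u ->].
  by rewrite mulmxA HG -[gen]genE -mulmxA gZ mulmxA submxMl.
move: kG; rewrite mxrank_ker => kG.
have N1E : (\sum_(b : arrow DQ) \rank (E (atail b)) * \rank (E (ahead b)) =
    2 * \sum_(a : arrow Q) d (atail a) * d (ahead a))%N.
  rewrite big_sumType /= mul2n -addnn; congr addn.
  by apply: eq_bigr => a _; rewrite mulnC.
have arith n0 n1 s r p e : (n1 = 2 * s -> n0 - r <= e -> r <= p -> r <= n0 ->
    r + p <= n1 -> n0 <= s + e)%N by lia.
exact: arith N1E kG rDP (rank_leq_row D) (mulmx0_rank_max DP0).
Qed.

End PreprojectiveBound.

(** * Indecomposables are bricks *)

Definition tits_positive (Q : quiver) := forall d : vertex Q -> nat,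
  (exists i, d i != 0)%N ->
  (\sum_(a : arrow Q) d (atail a) * d (ahead a) < \sum_i d i * d i)%N.

Definition qbrick (k : fieldType) (Q : quiver) n (E : vertex Q -> 'M[k]_n)
    (A : arrow Q -> 'M[k]_n) :=
  (0 < n)%N /\ forall H, qhom E A E A H -> H != 0 -> H \in unitmx.

Definition qindec (k : fieldType) (Q : quiver) n (E : vertex Q -> 'M[k]_n)
    (A : arrow Q -> 'M[k]_n) :=
  (0 < n)%N /\ forall P, qhom E A E A P -> P *m P = P -> P = 0 \/ P = 1%:M.

Lemma qrep_rank_neq0 (k : fieldType) (Q : quiver) n (E : vertex Q -> 'M[k]_n)
    (A : arrow Q -> 'M[k]_n) :
  qrep E A -> (0 < n)%N -> exists i, (\rank (E i) != 0)%N.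
Proof.
move=> EA n0; apply/not_existsP => h.
have : \rank (1%:M : 'M[k]_n) = 0%N.
  rewrite -(qrepE1 EA) big1 ?mxrank0 // => i _; apply/eqP; rewrite -mxrank_eq0.
  by apply/negPn/negP; exact: h.
by rewrite mxrank1; lia.
Qed.

Section Homs.
Variables (k : fieldType) (Q : quiver).

Lemma qhom_comp l m n (E : vertex Q -> 'M[k]_l) A (E' : vertex Q -> 'M[k]_m) A'
    (E'' : vertex Q -> 'M[k]_n) A'' X Y :
  qhom E A E' A' X -> qhom E' A' E'' A'' Y -> qhom E A E'' A'' (X *m Y).
Proof.
move=> [x1 x2] [y1 y2]; split=> i.
  by rewrite mulmxA x1 -!mulmxA y1.
by rewrite mulmxA x2 -!mulmxA y2.
Qed.

Lemma qhom1 n (E : vertex Q -> 'M[k]_n) A : qhom E A E A 1%:M.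
Proof. by split=> i; rewrite mul1mx mulmx1. Qed.

Lemma qhomB m n (E : vertex Q -> 'M[k]_m) A (E' : vertex Q -> 'M[k]_n) A' X Y :
  qhom E A E' A' X -> qhom E A E' A' Y -> qhom E A E' A' (X - Y).
Proof.
by move=> [x1 x2] [y1 y2]; split=> i; rewrite mulmxBl mulmxBr ?x1 ?y1 ?x2 ?y2.
Qed.

Lemma qhom_inv n (E : vertex Q -> 'M[k]_n) A X :
  qhom E A E A X -> X \in unitmx -> qhom E A E A (invmx X).
Proof.
have aux Y : X \in unitmx -> Y *m X = X *m Y -> Y *m invmx X = invmx X *m Y.
  by move=> uX e; rewrite -[LHS](mulKmx uX) (mulmxA X) -e mulmxK.
by move=> [x1 x2] uX; split=> i; apply: aux.
Qed.

Lemma qrep_restrict m n (E : vertex Q -> 'M[k]_n) A (E' : vertex Q -> 'M[k]_m) A' B :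
  qrep E A -> qhom E' A' E A B -> row_free B -> qrep E' A'.
Proof.
move=> EA [b1 b2] fB.
have inj := row_free_inj fB.
split=> [i|i j ij||a|a]; apply: inj.
- by rewrite -mulmxA b1 mulmxA b1 -mulmxA (qrepEE EA).
- by rewrite -mulmxA b1 mulmxA b1 -mulmxA (qrepE0 EA) // mulmx0 mul0mx.
- by rewrite mulmx_suml (eq_bigr _ (fun i _ => b1 i)) -mulmx_sumr (qrepE1 EA) mulmx1 mul1mx.
- by rewrite -mulmxA b2 mulmxA b1 -mulmxA (qrep_tail EA).
- by rewrite -mulmxA b1 mulmxA b2 -mulmxA (qrep_head EA).
Qed.

Lemma qrep_retract m n (E : vertex Q -> 'M[k]_n) A (p : 'M_(n, m)) (i : 'M_(m, n)) :
  qrep E A -> qhom E A E A (p *m i) -> i *m p = 1%:M ->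
  [/\ qrep (fun j => i *m E j *m p) (fun a => i *m A a *m p),
      qhom (fun j => i *m E j *m p) (fun a => i *m A a *m p) E A i
    & qhom E A (fun j => i *m E j *m p) (fun a => i *m A a *m p) p].
Proof.
move=> EA [h1 h2] ip.
have hi : qhom (fun j => i *m E j *m p) (fun a => i *m A a *m p) E A i.
  split=> j; rewrite -!mulmxA; first by rewrite h1 !mulmxA ip mul1mx.
  by rewrite h2 !mulmxA ip mul1mx.
have fi : row_free i by apply/row_freeP; exists p.
split=> //; first exact: qrep_restrict EA hi fi.
split=> j; rewrite !mulmxA.
  by rewrite -h1 -!mulmxA ip mulmx1.
by rewrite -h2 -!mulmxA ip mulmx1.
Qed.

End Homs.

Section Brick.
Variables (k : fieldType) (Q : quiver) (n : nat).
Variables (E : vertex Q -> 'M[k]_n) (A : arrow Q -> 'M[k]_n).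
Hypothesis EA : qrep E A.
Hypothesis posQ : tits_positive Q.
Hypothesis brick : qbrick E A.

Let rank_pos : (\sum_a \rank (E (atail a)) * \rank (E (ahead a)) <
  \sum_i \rank (E i) * \rank (E i))%N.
Proof. exact/(posQ (d := fun i => \rank (E i)))/(qrep_rank_neq0 EA brick.1). Qed.

(* If some cocycle [g] is not a coboundary, [H |-> H g] embeds the division ring
   of endomorphisms into the cokernel of the coboundary map, which forces the
   Tits form to be nonpositive. *)
Lemma brick_rigid g : arrow_graded E g ->
  exists2 H, graded E H & forall a, cobound A H a = g a.
Proof.
have [Z [W [D [[lZ gZ iZ sZ] [lW gW iW sW] WD]]]] := cochain_coord EA.
move=> gg; have [u Hu] := sW g gg.
have [/submxP[h uh]|nu] := boolP (u <= D)%MS.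
  by exists (Z h) => // a; rewrite -WD -uh Hu.
exfalso.
have W0 a : W 0 a = 0 by exact: (linear_fun0 (lW a)).
have endZ h : h *m D = 0 -> qhom E A E A (Z h).
  by move=> hD; split=> [|a]; [exact: gZ | apply: cobound_eq0 => b; rewrite -WD hD].
have unitZ h : h *m D = 0 -> h != 0 -> Z h \in unitmx.
  move=> hD h0; apply: brick.2; first exact: endZ.
  by apply: contraNN h0 => /eqP/iZ ->.
have ex h : exists w, forall a, W w a = Z h *m g a.
  by apply: sW => a; rewrite mulmxA gZ -!mulmxA mulmxA; rewrite mulmxA -2!mulmxA (mulmxA (E _)) gg.
pose f h := sval (cid (ex h)).
have Hf h a : W (f h) a = Z h *m g a by rewrite /f; case: cid.
have W_B w w' a : W (w - w') a = W w a - W w' a.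
  by have := lW a (-1) w' w; rewrite !scaleN1r ![- _ + _]addrC.
have [|M HM] := @linear_mxE _ _ _ f.
  move=> c h h'; apply/eqP; rewrite -subr_eq0; apply/eqP; apply: iW => a.
  by rewrite W_B (lW a c) !Hf lZ mulmxDl -scalemxAl subrr.
have d1 : (kermx D :&: kermx M)%MS = 0.
  apply/eqP/rowV0P => h; rewrite sub_capmx => /andP[/sub_kermxP hD /sub_kermxP hM].
  apply/eqP/negPn/negP => /(unitZ _ hD) uZ.
  move/negP: nu; apply; rewrite (iW u) ?sub0mx // => a.
  by rewrite Hu -[g a](mulKmx uZ) -Hf -HM hM W0 mulmx0.
(* If H g is the coboundary of H' for an invertible endomorphism H, then g is the coboundary of H^-1
   H'. *)
have d2 : (kermx D *m M :&: D)%MS = 0.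
  apply/eqP/rowV0P => w; rewrite sub_capmx => /andP[/submxP[x ->] /submxP[h']].
  rewrite mulmxA; set h := x *m _ => e.
  have hD : h *m D = 0 by rewrite -mulmxA mulmx_ker mulmx0.
  have [->|/(unitZ _ hD) uZ] := eqVneq h 0; first by rewrite mul0mx.
  have eg a : Z h *m g a = cobound A (Z h') a by rewrite -Hf -HM e WD.
  have [q1 q2] := qhom_inv (endZ _ hD) uZ.
  have [|h2 Hh2] := sZ (invmx (Z h) *m Z h').
    by move=> i; rewrite mulmxA q1 -!mulmxA gZ.
  case/negP: nu; apply/submxP; exists h2.
  apply/eqP; rewrite -subr_eq0; apply/eqP; apply: iW => a.
  rewrite W_B WD Hh2 Hu; apply/eqP; rewrite subr_eq0; apply/eqP.
  rewrite -[g a](mulKmx uZ) eg /cobound mulmxBr !mulmxA; congr (_ - _).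
  by rewrite q2.
have := mxrank_mul_ker (kermx D) M; rewrite d1 mxrank0 addn0.
have := mxrank_disjoint_sum d2; rewrite mxrank_ker => e1 e2.
move: e1; rewrite e2 => e1.
have := rank_leq_col (kermx D *m M + D)%MS; rewrite e1.
have := rank_leq_row D.
have arith n0 n1 r : (n1 < n0 -> r <= n0 -> n0 - r + r <= n1 -> False)%N by lia.
by move=> ? ?; apply: arith rank_pos _ _; eassumption.
Qed.

(** Rigidity makes [D] surjective, so m = dim End is the value of the Tits form at the dimension
    vector. Each vertex space is a vector space over the division ring End, so m divides its
    dimension; hence m^2 divides m and m = 1. *)
Lemma brick_scalar H : qhom E A E A H -> exists c, H = c%:M.
Proof.
have [Z [W [D [[lZ gZ iZ sZ] [lW gW iW sW] WD]]]] := cochain_coord EA.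
have W0 a : W 0 a = 0 by exact: (linear_fun0 (lW a)).
have endZ h : h *m D = 0 -> qhom E A E A (Z h).
  by move=> hD; split=> [|a]; [exact: gZ | apply: cobound_eq0 => b; rewrite -WD hD].
have Zend X : qhom E A E A X -> exists2 h, h *m D = 0 & Z h = X.
  move=> [x1 x2]; have [h Hh] := sZ X x1; exists h => //.
  by apply: iW => a; rewrite WD Hh /cobound x2 subrr.
have unitZ h : h *m D = 0 -> h != 0 -> Z h \in unitmx.
  move=> hD h0; apply: brick.2; first exact: endZ.
  by apply: contraNN h0 => /eqP/iZ ->.
have rD : row_full D.
  rewrite -sub1mx; apply/rV_subP => u _.
  have [Y gY HY] := brick_rigid (gW u); have [h Hh] := sZ Y gY.
  apply/submxP; exists h; apply/eqP; rewrite -subr_eq0; apply/eqP; apply: iW => a.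
  have := lW a (-1) (h *m D) u; rewrite !scaleN1r ![- _ + _]addrC => ->.
  by rewrite WD Hh HY subrr.
have rK : \rank (kermx D) = (\sum_i \rank (E i) * \rank (E i) -
    \sum_a \rank (E (atail a)) * \rank (E (ahead a)))%N.
  by rewrite mxrank_ker; move/eqP: rD => ->.
set m := \rank (kermx D) in rK.
have dvd_stable (U : 'M_n) : (forall X, qhom E A E A X -> U *m X <= U)%MS -> (m %| \rank U)%N.
  move=> stU.
  (* Replaces a choice of basis over the division ring: a stable [V] inside [U] is enlarged by an
     orbit x End with x outside [V]. The orbit has dimension m and meets [V] trivially, since
     nonzero endomorphisms are invertible. *)
  suff grow r (V : 'M_n) : (\rank U - \rank V <= r)%N -> (V <= U)%MS -> (m %| \rank V)%N ->
     (forall X, qhom E A E A X -> V *m X <= V)%MS -> (m %| \rank U)%N.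
    by apply: (grow _ 0) => [|||X _]; rewrite ?sub0mx ?mxrank0 ?dvdn0 ?mul0mx // leqnn.
  elim: r V => [|r IH] V rV VU mV stV.
    have e : \rank U = \rank V by have := mxrankS VU; lia.
    by rewrite e.
  have [UV|/row_subPn[j nj]] := boolP (U <= V)%MS.
    by have -> : \rank U = \rank V by apply/eqP; rewrite eqn_leq (mxrankS UV) (mxrankS VU).
  set x := row j U in nj.
  have [|G HG] := @linear_mxE k _ _ (fun h => x *m Z h).
    by move=> c u v; rewrite lZ mulmxDr -scalemxAr.
  have d1 : (kermx D :&: kermx G)%MS = 0.
    apply/eqP/rowV0P => h; rewrite sub_capmx => /andP[/sub_kermxP hD /sub_kermxP].
    rewrite HG => xh; apply/eqP/negPn/negP => /(unitZ _ hD) uZ.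
    by case/negP: nj; rewrite -[x](mulmxK uZ) xh mul0mx sub0mx.
  set X := kermx D *m G.
  have rX : \rank X = m by have := mxrank_mul_ker (kermx D) G; rewrite d1 mxrank0 addn0.
  have XP w : (w <= X)%MS -> exists2 h, h *m D = 0 & w = x *m Z h.
    move=> /submxP[y ->]; exists (y *m kermx D); first by rewrite -mulmxA mulmx_ker mulmx0.
    by rewrite -HG mulmxA.
  have XI h : h *m D = 0 -> (x *m Z h <= X)%MS.
    by move=> /sub_kermxP/submxP[y yh]; rewrite -HG yh -mulmxA submxMl.
  have d2 : (V :&: X)%MS = 0.
    apply/eqP/rowV0P => w; rewrite sub_capmx => /andP[wV /XP[h hD ew]].
    have [h0|/(unitZ _ hD) uZ] := eqVneq h 0.
      by rewrite ew h0 (linear_fun0 lZ) mulmx0.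
    case/negP: nj; rewrite -[x](mulmxK uZ) -ew.
    exact: submx_trans (submxMr _ wV) (stV _ (qhom_inv (endZ _ hD) uZ)).
  have rVX : \rank (V + X)%MS = (\rank V + m)%N by rewrite mxrank_disjoint_sum // rX.
  have m0 : (0 < m)%N.
    have [h hD h1] := Zend _ (qhom1 E A).
    rewrite lt0n mxrank_eq0; apply/negP => /eqP K0.
    have /submxP[y] : (h <= kermx D)%MS by apply/sub_kermxP.
    rewrite K0 mulmx0 => h0; move: h1; rewrite h0 (linear_fun0 lZ) => /esym/eqP.
    rewrite -mxrank_eq0 mxrank1; have := brick.1; lia.
  apply: (IH (V + X)%MS).
  - by rewrite rVX; lia.
  - rewrite addsmx_sub VU; apply/rV_subP => w /XP[h hD ->].
    exact: submx_trans (submxMr _ (row_sub j U)) (stU _ (endZ _ hD)).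
  - by rewrite rVX dvdn_addr.
  move=> Y hY; rewrite addsmxMr; apply: addsmxS; first exact: stV.
  apply/rV_subP => w /submxP[y ->]; rewrite mulmxA.
  have /XP[h hD ->] : (y *m X <= X)%MS by rewrite submxMl.
  have [h' hD' e] := Zend _ (qhom_comp (endZ _ hD) hY).
  by rewrite -mulmxA -e; apply: XI.
have dvdE i : (m %| \rank (E i))%N.
  by apply: dvd_stable => X [x1 _]; rewrite x1 submxMl.
have m1 : m = 1%N.
  have : (m * m %| m)%N.
    rewrite {3}rK dvdn_sub //; [by apply: dvdn_sum => i _; rewrite dvdn_mul|].
    by apply: dvdn_sum => a _; rewrite dvdn_mul.
  have : (0 < m)%N by rewrite rK subn_gt0.
  move=> mp; rewrite -{3}[m]muln1 dvdn_pmul2l // dvdn1 => /eqP //.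
move=> /Zend[h hD <-]; have [h1 h1D e1] := Zend _ (qhom1 E A).
have kh : (h <= kermx D)%MS by apply/sub_kermxP.
have kh1 : (h1 <= kermx D)%MS by apply/sub_kermxP.
have Z0 : Z 0 = 0 by exact: (linear_fun0 lZ).
have h10 : h1 != 0.
  apply/negP => /eqP h0; move: e1; rewrite h0 Z0 => /esym/eqP.
  rewrite -mxrank_eq0 mxrank1; have := brick.1; lia.
have : (kermx D <= h1)%MS.
  rewrite -(geq_leqif (mxrank_leqif_sup kh1)) -/m m1.
  by rewrite rank_rV h10.
move=> /(submx_trans kh)/sub_rVP[c ->]; exists c.
by have := lZ c h1 0; rewrite !addr0 Z0 addr0 e1 => ->; rewrite scalemx1.
Qed.

End Brick.

(** * Ringel's argument: indecomposables are bricks *)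

Lemma ex_min_rank (k : fieldType) m n (P : 'M[k]_(m, n) -> Prop) :
  (exists X, P X) -> exists2 X, P X & forall Y, P Y -> (\rank X <= \rank Y)%N.
Proof.
move=> [X0 PX0].
have ex : exists r, `[< exists2 X, P X & \rank X = r >].
  by exists (\rank X0); apply/asboolP; exists X0.
case: (ex_minnP ex) => r /asboolP[X PX rX] min; exists X => // Y PY.
by rewrite rX; apply: min; apply/asboolP; exists Y.
Qed.

Lemma kermx_mul0 (k : fieldType) m n p (X : 'M[k]_(m, n)) (Y : 'M[k]_(m, p)) :
  kermx X *m Y = 0 -> Y = X *m (pinvmx X *m Y).
Proof.
move=> kY; apply/eqP; rewrite -subr_eq0 mulmxA -[Y in Y - _]mul1mx -mulmxBl.
have /submxP[Z ->] : (1%:M - X *m pinvmx X <= kermx X)%MS.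
  by apply/sub_kermxP; rewrite mulmxBl mul1mx mulmxKpV // subrr.
by rewrite -mulmxA kY mulmx0.
Qed.

Section Ringel.
Variables (k : fieldType) (Q : quiver).

(** The Fitting decomposition when the rank has already stabilized: H = Y H^2 and H = H^2 X give H X
    = Y H, an idempotent with the same kernel and image as H. The two expressions together make it
    commute with everything that commutes with H. *)
Lemma qindec_sqr0 n (E : vertex Q -> 'M[k]_n) A H :
  qindec E A -> qhom E A E A H -> \rank (H *m H) = \rank H ->
  H = 0 \/ H \in unitmx.
Proof.
move=> [_ ind] [h1 h2] rH.
have /submxP[Y HY] : (H <= H *m H)%MS.
  by rewrite -(geq_leqif (mxrank_leqif_sup (submxMl H H))) rH.
have /submxP[X' HX'] : (H^T <= H^T *m H^T)%MS.
  rewrite -(geq_leqif (mxrank_leqif_sup (submxMl H^T H^T))) -trmx_mul.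
  by rewrite !mxrank_tr rH.
pose X := X'^T; have HX : H = H *m H *m X.
  by rewrite -[LHS]trmxK HX' !trmx_mul !trmxK.
have eXY : H *m X = Y *m H.
  by rewrite {1}HY -mulmxA -HX.
have eH : H *m X *m H = H by rewrite eXY -mulmxA -HY.
have He : H *m (H *m X) = H by rewrite mulmxA -HX.
have comm B : B *m H = H *m B -> B *m (H *m X) = (H *m X) *m B.
  move=> BH; transitivity ((H *m X) *m B *m (H *m X)).
    by rewrite !mulmxA BH -(mulmxA (H *m X)) BH !mulmxA eH.
  by rewrite eXY -!mulmxA (mulmxA H) -BH -(mulmxA B) -eXY He BH.
have [||e0|e1] := ind (H *m X).
- by split=> [i|a]; apply: comm.
- by rewrite [LHS]mulmxA eH.
- by left; rewrite -eH e0 mul0mx.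
by right; have /mulmx1_unit[] := e1.
Qed.

(* Ringel: take an endomorphism [T] of minimal rank among the nonzero singular
   ones, so [T^2 = 0]; a summand [L] of its kernel that meets its image is
   rigid by induction, so [L] splits off. *)
Theorem indec_brick : tits_positive Q ->
  forall n (E : vertex Q -> 'M[k]_n) A, qrep E A -> qindec E A -> qbrick E A.
Proof.
move=> posQ; elim/ltn_ind => n IH E A EA ind; split; first exact: ind.1.
move=> H0 hH0 nz0; apply/negPn/negP => nu0.
have [T [[t1 t2] Tnz Tnu] Tmin] := @ex_min_rank k n n
  (fun H => [/\ qhom E A E A H, H != 0 & H \notin unitmx]) (ex_intro _ H0 (And3 hH0 nz0 nu0)).
(* Otherwise T^2 competes in the minimality of [T], so T^2 and T have equal rank and [qindec_sqr0]
   applies. *)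
have TT : T *m T = 0.
  apply/eqP/negPn/negP => nz.
  have [||T0|uT] := qindec_sqr0 (H := T) ind.
  - by split.
  - apply/eqP; rewrite eqn_leq mxrankM_maxl Tmin //; split=> //.
      exact: qhom_comp (conj t1 t2) (conj t1 t2).
    by rewrite unitmx_mul (negPf Tnu).
  - by rewrite T0 eqxx in Tnz.
  by rewrite uT in Tnu.
set r := \rank (kermx T).
have [B [fB BT kB]] : exists B : 'M[k]_(r, n), [/\ row_free B, B *m T = 0 & (kermx T <= B)%MS].
  exists (row_base (kermx T)); rewrite row_base_free eq_row_base; split=> //.
  by apply/sub_kermxP; rewrite eq_row_base.
have rr : (r < n)%N.
  rewrite /r mxrank_ker; have := rank_leq_row T.
  by move: Tnz; rewrite -mxrank_eq0; lia.
have /row_freeP[Bi BBi] := fB.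
have stab X : X *m T = T *m X -> B *m X = (B *m X *m Bi) *m B.
  move=> XT; have /submxP[Y ->] : (B *m X <= B)%MS.
    apply: submx_trans kB; apply/sub_kermxP.
    by rewrite -mulmxA XT mulmxA BT mul0mx.
  by rewrite -(mulmxA Y) BBi mulmx1.
pose EK i := B *m E i *m Bi; pose AK a := B *m A a *m Bi.
have hB : qhom EK AK E A B.
  by split=> i; rewrite /EK /AK -stab.
have EAK := qrep_restrict EA hB fB.
clearbody EK AK.
have [t Tt] : exists t, T = t *m B.
  by apply/submxP; apply: submx_trans kB; apply/sub_kermxP.
have injB := row_free_inj fB.
have ht : qhom E A EK AK t.
  split=> i; apply: injB; rewrite -mulmxA -Tt -mulmxA.
    by rewrite hB.1 t1 Tt mulmxA.
  by rewrite hB.2 t2 Tt mulmxA.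
have tnz : t != 0 by apply: contraNneq Tnz => t0; rewrite Tt t0 mul0mx.
have Bt : B *m t = 0 by apply: injB; rewrite mul0mx -mulmxA -Tt.
have [P [[hP PP] tP] Pmin] := @ex_min_rank k r r
  (fun P => [/\ qhom EK AK EK AK P /\ P *m P = P & t *m P != 0])
  (ex_intro _ 1%:M (conj (conj (qhom1 EK AK) (mulmx1 _)) (etrans (congr1 (fun X => X != 0) (mulmx1 t)) tnz))).
have [[p i] /= pi ip] := idem_factor PP.
set l := \rank P in p i pi ip Pmin.
have := hP; rewrite -pi => hpi.
have [EAL hi hp] := qrep_retract EAK hpi ip.
set EL := (fun _ => _) in EAL hi hp; set AL := (fun _ : arrow Q => _) in EAL hi hp.
clearbody EL AL.
have l0 : (0 < l)%N.
  rewrite lt0n mxrank_eq0; apply: contraNneq tP => ->.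
  by rewrite mulmx0.
have indL : qindec EL AL.
  split=> // R hR RR.
  have corner S : qhom EL AL EL AL S -> S *m S = S -> t *m (p *m S *m i) != 0 -> S = 1%:M.
    move=> hS SS nz.
    have rS : (l <= \rank S)%N.
      apply: leq_trans (leq_trans (mxrankM_maxl (p *m S) i) (mxrankM_maxr p S)).
      apply: Pmin; split=> //; split; first exact: qhom_comp (qhom_comp hp hS) hi.
      by rewrite -!mulmxA (mulmxA i) ip mul1mx (mulmxA S) SS.
    have uS : S \in unitmx by rewrite -row_free_unit -row_leq_rank.
    by rewrite -[S](mulKmx uS) SS mulVmx.
  have [z|nz] := eqVneq (t *m (p *m R *m i)) 0; last by right; apply: corner.
  left; have e : 1%:M - R = 1%:M.
    apply: corner; first exact: qhomB (qhom1 _ _) hR.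
      by rewrite mulmxBr mulmx1 mulmxBl mul1mx RR subrr subr0.
    by rewrite mulmxBr mulmx1 mulmxBl mulmxBr z subr0 pi.
  by rewrite -[R](subKr 1%:M) e subrr.
have lr : (l <= r)%N := rank_leq_row P.
have brickL := IH l (leq_ltn_trans lr rr) EL AL EAL indL.
pose s := t *m p.
have hs : qhom E A EL AL s := qhom_comp ht hp.
have Bs : B *m s = 0 by rewrite mulmxA Bt mul0mx.
(* Composing [s] with the inclusion of L gives a nonzero singular endomorphism of rank at least that
   of [T]; so [s] has the same kernel K as [T]. *)
have ks : (kermx s <= B)%MS.
  have rs : (\rank T <= \rank s)%N.
    apply: leq_trans (mxrankM_maxl s (i *m B)); apply: Tmin; split.
    - exact: qhom_comp hs (qhom_comp hi hB).
    - apply: contraNneq tP => z.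
      by rewrite -pi mulmxA; apply/eqP; apply: injB; rewrite mul0mx -mulmxA z.
    apply/negP => u; have B0 : B = 0 by rewrite -[B](mulmxK u) (mulmxA B) Bs !mul0mx.
    by have := lr; rewrite -(eqP fB) B0 mxrank0; lia.
  have Bks : (B <= kermx s)%MS by apply/sub_kermxP.
  rewrite -(geq_leqif (mxrank_leqif_sup Bks)) (eqP fB) /r !mxrank_ker.
  by rewrite leq_sub2l.
(* A retraction onto K that respects vertices but perhaps not arrows. Its defect after projection to
   L is the cocycle [c] below, which has to be corrected. *)
have [S [gS BS]] : exists S : 'M[k]_(n, r), (forall j, E j *m S = S *m EK j) /\ B *m S = 1%:M.
  exists (\sum_j E j *m Bi *m EK j); split=> [j|].
    rewrite mulmx_sumr mulmx_suml (bigD1 j) //= [RHS](bigD1 j) //= !mulmxA (qrepEE EA).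
    rewrite -(mulmxA _ (EK j)) (qrepEE EAK); congr (_ + _).
    rewrite !big1 // => x xj; first by rewrite -mulmxA (qrepE0 EAK) // mulmx0.
    by rewrite !mulmxA (qrepE0 EA) ?mul0mx // eq_sym.
  rewrite mulmx_sumr -(qrepE1 EAK); apply: eq_bigr => j _.
  by rewrite !mulmxA -hB.1 -(mulmxA _ B) BBi mulmx1 (qrepEE EAK).
pose r0 := S *m p.
have gr0 j : E j *m r0 = r0 *m EL j by rewrite mulmxA gS -!mulmxA hp.1.
have Br0 : B *m r0 = p by rewrite mulmxA BS mul1mx.
clearbody r0 s.
pose c a := A a *m r0 - r0 *m AL a.
have Bc a : B *m c a = 0.
  by rewrite mulmxBr !mulmxA -hB.2 -(mulmxA _ B) Br0 hp.2 subrr.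
(* This is where heredity enters: [c] vanishes on K = ker s, so it lives on the image of [s] in L.
   As a path algebra has no relations to respect, it extends to a cocycle on L, which is a
   coboundary by rigidity. *)
have [g cs] : exists g, forall a, c a = s *m g a.
  exists (fun a => pinvmx s *m c a) => a; apply: kermx_mul0; have /submxP[Y ->] := ks.
  by rewrite -mulmxA Bc mulmx0.
have gc a : E (atail a) *m c a *m EL (ahead a) = c a.
  rewrite mulmxBr mulmxBl !mulmxA (qrep_tail EA) gr0; congr (_ - _).
    by rewrite -(mulmxA (A a)) -gr0 mulmxA (qrep_head EA).
  by rewrite -!mulmxA (qrep_head EAL) (qrep_tail EAL).
have [|H gH HH] := brick_rigid EAL posQ brickL
    (g := fun a => EL (atail a) *m g a *m EL (ahead a)).
  by move=> a; rewrite !mulmxA (qrepEE EAL) -!mulmxA (qrepEE EAL).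
(* Subtracting s H cancels the defect without changing the restriction to K, so [r1] is a
   homomorphism splitting the inclusion of L. *)
pose r1 := r0 - s *m H.
have hr1 : qhom E A EL AL r1.
  split=> [j|a].
    by rewrite mulmxBr mulmxBl gr0 mulmxA hs.1 -!mulmxA gH.
  apply/eqP; rewrite -subr_eq0; apply/eqP.
  have -> : A a *m r1 - r1 *m AL a = c a - s *m cobound AL H a.
    rewrite /r1 /c /cobound !mulmxBr mulmxBl !mulmxA hs.2 !opprB !addrA.
    by rewrite [LHS]addrAC [RHS]addrAC -!addrA; congr (_ + _); rewrite addrCA addrA addrC.
  by rewrite HH !mulmxA -hs.1 -(mulmxA _ s) -cs gc subrr.
have iBr1 : (i *m B) *m r1 = 1%:M.
  by rewrite mulmxBr -!mulmxA Br0 ip (mulmxA B) Bs mul0mx mulmx0 subr0.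
have [||z|o] := ind.2 (r1 *m (i *m B)).
- exact: qhom_comp hr1 (qhom_comp hi hB).
- by rewrite [LHS]mulmxA -(mulmxA r1) iBr1 mulmx1.
- have := congr1 (fun X => \rank (i *m B *m X)) z.
  rewrite mulmxA iBr1 mul1mx mulmx0 mxrank0 => /eqP; rewrite mxrank_eq0 => /eqP iB0.
  have := congr1 mxrank iBr1; rewrite iB0 mul0mx mxrank0 mxrank1; lia.
have := congr1 mxrank o; rewrite mxrank1.
by have := mulmx_max_rank r1 (i *m B); lia.
Qed.

End Ringel.

(** * Lifting a brick to the double quiver by trace duality *)

(** A subspace of matrices is its own double annihilator for the trace form. *)
Lemma trace_dual_image (k : fieldType) m n (f : 'rV[k]_m -> 'M[k]_n) (T : 'M[k]_n) :
  linear f -> (forall X, (forall u, \tr (f u *m X) = 0) -> \tr (T *m X) = 0) ->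
  exists u, f u = T.
Proof.
move=> lf h.
have [|M HM] := @linear_mxE k _ _ (fun u => mxvec (f u)).
  by move=> c u v; rewrite lf linearP.
have [/submxP[u Hu]|] := boolP (mxvec T <= M)%MS.
  by exists u; apply: (can_inj mxvecK); rewrite Hu HM.
rewrite submxE => nz.
(* Reshaped into matrices, the columns of [cokermx M] are trace functionals that vanish on the image
   of [f]. *)
have trE Y (c : 'cV_(n * n)) : \tr (Y *m (vec_mx c^T)^T) = (mxvec Y *m c) 0 0.
  rewrite [RHS]mxE (reindex _ (curry_mxvec_bij _ _)) /= /mxtrace.
  rewrite (eq_bigr (fun i => \sum_j Y i j * c (mxvec_index i j) 0)) => [|i _].
    by rewrite pair_bigA; apply: eq_bigr => -[i j] _; rewrite /= mxvecE.
  by rewrite mxE; apply: eq_bigr => j _; rewrite !mxE.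
case/eqP: nz; apply/rowP => j; rewrite [RHS]mxE.
have colj (w : 'rV_(n * n)) : (w *m cokermx M) 0 j = (w *m col j (cokermx M)) 0 0.
  by rewrite colE mulmxA -colE [RHS]mxE.
rewrite colj -trE; apply: h => u.
by rewrite trE -HM -colj -mulmxA mulmx_coker mulmx0 mxE.
Qed.

Section Lift.
Variables (k : fieldType) (Q : quiver) (n : nat).
Variables (E : vertex Q -> 'M[k]_n) (A : arrow Q -> 'M[k]_n).
Hypothesis EA : qrep E A.

(** The vertex-diagonal part of a matrix orthogonal to all sums of commutators [A a, S a] is an
    endomorphism, hence a scalar. So the only obstruction to reaching the right-hand side is its
    trace, the weighted sum of dimensions. *)
Lemma brick_lift (v : vertex Q -> k) :
  (forall H, qhom E A E A H -> exists c, H = c%:M) ->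
  \sum_i v i * (\rank (E i))%:R = 0 ->
  exists2 S : arrow Q -> 'M[k]_n,
    forall a, E (ahead a) *m S a = S a /\ S a *m E (atail a) = S a
  & \sum_a (A a *m S a - S a *m A a) = \sum_i v i *: E i.
Proof.
move=> scal v0.
have [W lW [gW iW sW]] :=
  idem_corner_coord (fun a => qrepEE EA (ahead a)) (fun a => qrepEE EA (atail a)).
have WE u a : E (ahead a) *m W u a = W u a /\ W u a *m E (atail a) = W u a.
  split; first by rewrite -[in LHS]gW !mulmxA (qrepEE EA) gW.
  by rewrite -[in LHS]gW -!mulmxA (qrepEE EA) mulmxA gW.
pose f u := \sum_a (A a *m W u a - W u a *m A a).
suff [u Hu] : exists u, f u = \sum_i v i *: E i by exists (W u).
apply: trace_dual_image => [c u w|X hX].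
  rewrite /f scaler_sumr -big_split; apply: eq_bigr => a _ /=.
  rewrite lW mulmxDr mulmxDl -scalemxAr -scalemxAl scalerBr opprD addrACA.
  by [].
(* The products A S and S A and the target all lie in the diagonal corners, so traces against [X]
   only see this part of it. *)
pose H := \sum_i E i *m X *m E i.
have EH i : E i *m H = E i *m X *m E i.
  rewrite mulmx_sumr (bigD1 i) //= !mulmxA (qrepEE EA) big1 ?addr0 // => j ji.
  by rewrite !mulmxA (qrepE0 EA) ?mul0mx // eq_sym.
have HE i : H *m E i = E i *m X *m E i.
  rewrite mulmx_suml (bigD1 i) //= -!mulmxA (qrepEE EA) big1 ?addr0 // => j ji.
  by rewrite -!mulmxA (qrepE0 EA) // !mulmx0.
have gH : graded E H by move=> i; rewrite EH HE.
have trH i Y : \tr (E i *m Y *m E i *m X) = \tr (E i *m Y *m E i *m H).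
  by rewrite -!mulmxA EH -!mulmxA [RHS]mxtrace_mulC -!mulmxA (qrepEE EA)
     [LHS]mxtrace_mulC -!mulmxA.
have cH a : cobound A H a = 0.
  have gc := cobound_graded EA gH.
  apply: mxtrace_mul0 => Y.
  (* A family [S] supported on the arrow [a], with arbitrary value there: orthogonality becomes the
     vanishing of all traces of Y against the coboundary of [H] at [a]. *)
  have [u Hu] : exists u, forall b, W u b = if b == a then E (ahead b) *m Y *m E (atail b) else 0.
    apply: sW => b; case: eqP => _; last by rewrite mulmx0 mul0mx.
    by rewrite !mulmxA (qrepEE EA) -!mulmxA (qrepEE EA).
  have := hX u; rewrite /f mulmx_suml (bigD1 a) //= big1 => [|b ba]; last first.
    by rewrite Hu (negPf ba) mulmx0 mul0mx subrr mul0mx.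
  rewrite addr0 -(gc a) mulmxBl raddfB /= => e.
  have trt (Z : 'M[k]_n) i : E i *m Z = Z -> Z *m E i = Z -> \tr (Z *m X) = \tr (Z *m H).
    move=> z1 z2; have e1 : E i *m Z *m E i = Z by rewrite z1 z2.
    by rewrite -e1 trH.
  have [w1 w2] := WE u a.
  move: e; rewrite (trt _ (atail a)) ?mulmxA ?(qrep_tail EA) //; last by rewrite -mulmxA w2.
  rewrite (trt _ (ahead a)) ?mulmxA ?w1 //; last by rewrite -mulmxA (qrep_head EA).
  rewrite Hu eqxx => e.
  rewrite mxtrace_mulC !mulmxA /cobound mulmxBr raddfB /= -oppr0 -e opprB.
  rewrite !mulmxA; congr (_ - _).
  by rewrite mxtrace_mulC !mulmxA.
have [|c Hc] := scal H; first by split=> // a; apply: cobound_eq0.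
rewrite mulmx_suml raddf_sum /= (eq_bigr (fun i => c * (v i * (\rank (E i))%:R))).
  by rewrite -mulr_sumr v0 mulr0.
move=> i _; rewrite -scalemxAl mxtraceZ.
have := trH i 1%:M; rewrite !mulmx1 !(qrepEE EA) => ->.
by rewrite Hc mul_mx_scalar mxtraceZ idem_mxtrace ?(qrepEE EA) // mulrCA.
Qed.

End Lift.

(** * Path algebras and modules *)

Section LfunMatrix.
Variables (k : fieldType) (V : vectType k).
Import VectorInternalTheory.
Local Notation n := (dim V).

(* Transposed, so that composition of functions becomes the matrix product. *)
Definition lfun_mx (f : 'End(V)) : 'M[k]_n := (f2mx f)^T.
Definition mx_lfun (M : 'M[k]_n) : 'End(V) := Hom M^T.

Lemma mx_lfunK : cancel mx_lfun lfun_mx.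
Proof. by move=> M; rewrite /lfun_mx /= trmxK. Qed.

Lemma lfun_mxK : cancel lfun_mx mx_lfun.
Proof. by move=> f; apply: val_inj; rewrite /mx_lfun /= trmxK. Qed.

Let f2mxE (f : 'End(V)) u : u *m f2mx f = v2r (f (r2v u)).
Proof. by rewrite unlock /= !r2vK. Qed.

Let mulmx_ext m p (M M' : 'M[k]_(m, p)) : (forall u : 'rV_m, u *m M = u *m M') -> M = M'.
Proof. by move=> h; apply/row_matrixP => i; rewrite !rowE. Qed.

Lemma lfun_mx_comp f g : lfun_mx (f \o g)%VF = lfun_mx f *m lfun_mx g.
Proof.
rewrite /lfun_mx -trmx_mul; congr trmx; apply: mulmx_ext => u.
by rewrite mulmxA !f2mxE lfunE /= v2rK.
Qed.

Lemma lfun_mx1 : lfun_mx \1%VF = 1%:M.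
Proof.
rewrite -[RHS]trmx1; congr trmx; apply: mulmx_ext => u.
by rewrite f2mxE lfunE /= r2vK mulmx1.
Qed.

Lemma lfun_mx_linear : linear lfun_mx.
Proof.
move=> c f g; rewrite /lfun_mx -linearP; congr trmx; apply: mulmx_ext => u.
by rewrite mulmxDr -scalemxAr !f2mxE !lfunE /= lfunE linearP.
Qed.

Lemma dim_limg_lfun_mx f : \dim (limg f) = \rank (lfun_mx f).
Proof.
rewrite mxrank_tr unlock /dimv /= mxrank_gen.
by rewrite (eqmxMr _ (genmxE _)) mul1mx.
Qed.

End LfunMatrix.

(** The equation on the dimension is a parameter because the dimension of ['rV_n] is [1 * n]. *)
Lemma mx_lfun_iso (k : fieldType) (V : vectType k) n : dim V = n ->
  exists (phi : 'End(V) -> 'M[k]_n) (psi : 'M[k]_n -> 'End(V)),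
  [/\ linear phi, cancel psi phi, cancel phi psi,
     {morph phi : f g / (f \o g)%VF >-> f *m g}
   & phi \1%VF = 1%:M /\ forall f, \dim (limg f) = \rank (phi f)].
Proof.
case: n /; exists (@lfun_mx k V), (@mx_lfun k V); split.
- exact: lfun_mx_linear.
- exact: mx_lfunK.
- exact: lfun_mxK.
- exact: lfun_mx_comp.
by split; [exact: lfun_mx1 | exact: dim_limg_lfun_mx].
Qed.

Section PathAlgebraGenerators.
Variables (R : comNzRingType) (Q : quiver).
Local Notation A := (pathalg R Q).

Lemma pbasisM (p q : qpath Q) : pbasis p * pbasis q = pbmul R p q.
Proof. exact: pmul_basis. Qed.

Lemma pathalg_idemP :
  [/\ forall i : vertex Q, idem i * idem i = idem i :> A,
     forall i j : vertex Q, i != j -> idem i * idem j = 0 :> A,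
     \sum_(i : vertex Q) idem i = 1 :> A,
     forall a : arrow Q, idem (atail a) * arr a = arr a :> A
   & forall a : arrow Q, arr a * idem (ahead a) = arr a :> A].
Proof.
have e1 (p q r : qpath Q) : ptgt p = psrc q -> psrc r = psrc p ->
    pseq r = pseq p ++ pseq q -> pbasis p * pbasis q = pbasis r :> A.
  by move=> h1 h2 h3; rewrite pbasisM /pbmul (_ : Defs.pcomp p q = Some r) //; apply/pcompP.
split=> [i|i j ij||a|a]; try exact: e1.
- rewrite pbasisM /pbmul; case E: Defs.pcomp => [r|] //.
  by have /pcompP[/eqP] := E; rewrite (negPf ij).
- by rewrite -[RHS]/(pone) pone.unlock.
Qed.

Lemma pbasis_consE a s w w' :
  pbasis (@QPath Q (atail a, a :: s) w) =
  arr a * pbasis (@QPath Q (ahead a, s) w') :> A.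
Proof.
rewrite pbasisM /pbmul (_ : Defs.pcomp _ _ = Some (@QPath Q (atail a, a :: s) w)) //.
exact/pcompP.
Qed.

Lemma pathalg_ind (P : A -> Prop) :
  P 0 -> (forall x y, P x -> P y -> P (x + y)) ->
  (forall c x, P x -> P (c *: x)) -> (forall x y, P x -> P y -> P (x * y)) ->
  (forall i, P (idem i)) -> (forall a, P (arr a)) -> forall x, P x.
Proof.
move=> P0 PD PZ PM Pi Pa x; rewrite [x]pbasisE.
apply: (big_ind P) => // p _; apply: PZ.
case: p => -[i s] w; elim: s i w => [|a s IH] i w.
  have -> : QPath w = ptriv i by congr QPath; apply: bool_irrelevance.
  exact: Pi.
have /= := w; case/andP=> /eqP ai w'.
move: w; rewrite -ai => w.
by rewrite (pbasis_consE w w'); apply: PM.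
Qed.

End PathAlgebraGenerators.

Section PathLift.
Variables (R : comNzRingType) (Q : quiver) (U : lmodType R).

Definition plift (g : qpath Q -> U) (x : pathalg R Q) : U :=
  \sum_(p <- msupp x) x@_p *: g p.

Let pliftw g (d : {fset qpath Q}) (x : pathalg R Q) : (msupp x `<=` d)%fset ->
  plift g x = \sum_(p <- d) x@_p *: g p.
Proof.
move=> le; rewrite /plift (big_fset_incl _ le) // => p _ np.
by rewrite mcoeff_outdom // scale0r.
Qed.

Lemma plift_linear g : linear (plift g).
Proof.
move=> c x y; set d := (msupp x `|` msupp y)%fset.
have lx : (msupp x `<=` d)%fset by apply: fsubsetUl.
have ly : (msupp y `<=` d)%fset by apply: fsubsetUr.
have lxy : (msupp (c *: x + y) `<=` d)%fset.
  apply: fsubset_trans (msuppD_le _ _) _; rewrite pathalg_scaleE fsubUset ly andbT.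
  exact: fsubset_trans (msuppZ_le _ _) lx.
rewrite (pliftw _ lx) (pliftw _ ly) (pliftw _ lxy) scaler_sumr -big_split /=.
by apply: eq_bigr => p _; rewrite mcoeffD pcoeffZ scalerDl scalerA.
Qed.
HB.instance Definition _ g :=
  GRing.isLinear.Build R (pathalg R Q) U *:%R (plift g) (plift_linear g).

Lemma plift_basis g p : plift g (pbasis p) = g p.
Proof.
rewrite /plift pbasis.unlock msuppU oner_eq0 big_seq_fset1 mcoeffUU; exact: scale1r.
Qed.

Lemma pathalg_basis_ind (P : pathalg R Q -> Prop) :
  P 0 -> (forall x y, P x -> P y -> P (x + y)) -> (forall c x, P x -> P (c *: x)) ->
  (forall p, P (pbasis p)) -> forall x, P x.
Proof.
move=> P0 PD PZ Pb x; rewrite [x]pbasisE.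
by apply: (big_ind P) => // p _; apply: PZ.
Qed.

End PathLift.

Section PathEvaluation.
Variables (R : comNzRingType) (Q : quiver) (n : nat).
Variables (E : vertex Q -> 'M[R]_n) (A : arrow Q -> 'M[R]_n).
Hypothesis EA : qrep E A.

(** The empty walk gives [E i] and not the identity, so trivial paths become the idempotents and
    products of paths that do not compose vanish. *)
Let walkmx := fix walkmx i s : 'M[R]_n :=
  if s is a :: s' then A a *m walkmx (ahead a) s' else E i.

Let E_walkmx i s : walk i s -> E i *m walkmx i s = walkmx i s.
Proof.
case: s => [_|a s /= /andP[/eqP <- _]] /=; first exact: qrepEE EA i.
by rewrite mulmxA (qrep_tail EA).
Qed.

Let walkmx_E i s : walkmx i s *m E (last i (map (@ahead Q) s)) = walkmx i s.
Proof.
elim: s i => [|a s IH] i /=; first exact: (qrepEE EA).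
by rewrite -mulmxA IH.
Qed.

Let walkmx_cat i s t : walk (last i (map (@ahead Q) s)) t ->
  walkmx i (s ++ t) = walkmx i s *m walkmx (last i (map (@ahead Q) s)) t.
Proof.
elim: s i => [|a s IH] i /= w; first by rewrite E_walkmx.
by rewrite IH // mulmxA.
Qed.

Let pathmx (p : qpath Q) := walkmx (psrc p) (pseq p).

Let eval := plift pathmx.

Let eval_pbmul p q : eval (pbmul R p q) = pathmx p *m pathmx q.
Proof.
rewrite /pbmul; case e: Defs.pcomp => [r|].
  have /pcompP[h1 h2 h3] := e.
  rewrite /eval plift_basis /pathmx h2 h3 walkmx_cat -/(ptgt p) h1 //; exact: (valP q).
rewrite /eval linear0 -[pathmx p]walkmx_E -[pathmx q]E_walkmx; last exact: (valP q).
rewrite -/(ptgt p) -mulmxA (mulmxA (E _)) (qrepE0 EA) ?mul0mx ?mulmx0 //.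
apply/eqP => pq; move: e; rewrite /Defs.pcomp pq eqxx insubT //.
by rewrite walk_cat (valP p) -/(ptgt p) pq; exact: (valP q).
Qed.

(** The universal property of the path algebra. It serves over k to build modules from matrices, and
    over k[z] to make the Heisenberg algebra act. *)
Theorem pathalg_eval : exists F : pathalg R Q -> 'M[R]_n,
  [/\ linear F, {morph F : x y / x * y >-> x *m y}, F 1 = 1%:M,
     forall i, F (idem i) = E i & forall a, F (arr a) = A a].
Proof.
have Fi i : eval (idem i) = E i by rewrite /eval plift_basis.
have Fa a : eval (arr a) = A a by rewrite /eval plift_basis /pathmx /= (qrep_head EA).
exists eval; split => //; first exact: plift_linear; last first.
  have [_ _ <- _ _] := pathalg_idemP R Q; rewrite /eval linear_sum -(qrepE1 EA).
  by apply: eq_bigr => i _; exact: Fi.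
move=> x y; rewrite [x]pbasisE [y]pbasisE.
rewrite /eval mulr_suml !(linear_sum (plift pathmx)) mulmx_suml; apply: eq_bigr => p _.
rewrite mulr_sumr (linear_sum (plift pathmx)) mulmx_sumr; apply: eq_bigr => q _.
rewrite -pathalg_scalerAl -pathalg_scalerAr !(linearZ_LR (plift pathmx)) -scalemxAl -scalemxAr.
by rewrite pbasisM; congr (_ *: (_ *: _)); rewrite /= [LHS]eval_pbmul !plift_basis.
Qed.

End PathEvaluation.

(** * The dictionary between kQ-modules and matrix representations *)

Section Modules.
Variables (k : fieldType) (Q : quiver).

Lemma kQmodule_qrep (N : kQmodule k Q) : indecomposable N ->
  exists n (E : vertex Q -> 'M[k]_n) (A : arrow Q -> 'M[k]_n),
  [/\ qrep E A, qindec E A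
    & forall i, \dim (limg (modact N (idem i))) = \rank (E i)].
Proof.
move=> [N0 ind].
have [phi [psi [lphi psiK phiK phiM [phi1 phir]]]] := mx_lfun_iso (erefl (dim N)).
pose pl := GRing.isLinear.Build k 'End(N) 'M[k]_(dim N) *:%R phi lphi.
pose Phi : {linear 'End(N) -> 'M[k]_(dim N)} := HB.pack phi pl.
have phi0 : phi 0 = 0 := linear0 Phi.
have phi_sum I r (P : pred I) (f : I -> 'End(N)) : phi (\sum_(i <- r | P i) f i) = \sum_(i <- r | P i) phi (f i).
  exact: (linear_sum Phi).
have phiD f g : phi (f + g) = phi f + phi g := linearD Phi f g.
have phiZ c f : phi (c *: f) = c *: phi f := linearZ_LR Phi c f.
have [ii ij i1 ta ha] := pathalg_idemP k Q.
exists (dim N), (fun i => phi (modact N (idem i))), (fun a => phi (modact N (arr a))).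
split=> // [|].
  split=> [i|i j ne||a|a].
  - by rewrite -phiM -modactM ii.
  - by rewrite -phiM -modactM ij // linear0 phi0.
  - by rewrite -phi_sum -linear_sum i1 modact1 phi1.
  - by rewrite -phiM -modactM ta.
  - by rewrite -phiM -modactM ha.
split.
  by rewrite lt0n -dimvf dimv_eq0; apply/eqP.
move=> P [hP1 hP2] PP.
pose p := psi P.
have pp : (p \o p)%VF = p by apply: (can_inj phiK); rewrite phiM psiK.
have comm (x : pathalg k Q) : (modact N x \o p)%VF = (p \o modact N x)%VF.
  apply: (can_inj phiK); rewrite !phiM psiK.
  elim/pathalg_ind: x => [|x y hx hy|c x hx|x y hx hy|i|a] //.
  - by rewrite linear0 phi0 mul0mx mulmx0.
  - by rewrite linearD phiD mulmxDl mulmxDr hx hy.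
  - by rewrite linearZ phiZ -scalemxAl -scalemxAr hx.
  - by rewrite modactM phiM -mulmxA hy mulmxA hx mulmxA.
have ppv v : p (p v) = p v by rewrite -[RHS](congr1 (fun f : 'End(N) => f v) pp) lfunE.
have commv x v : modact N x (p v) = p (modact N x v).
  by have := congr1 (fun f : 'End(N) => f v) (comm x); rewrite !lfunE.
have [||||U0|W0] := ind (limg p) (lker p).
- move=> x; apply/subvP => _ /memv_imgP[_ /memv_imgP[v _ ->] ->].
  by rewrite commv memv_img ?memvf.
- move=> x; apply/subvP => _ /memv_imgP[v vk ->].
  by rewrite memv_ker -commv; move: vk; rewrite memv_ker => /eqP ->; rewrite linear0.
- apply/vspaceP => v; rewrite memvf; apply/memv_addP.
  exists (p v); first by rewrite memv_img ?memvf.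
  by exists (v - p v); [rewrite memv_ker linearB /= ppv subrr | rewrite addrC subrK].
- apply/eqP; rewrite -subv0; apply/subvP => v; rewrite memv_cap memv0.
  by move=> /andP[/memv_imgP[u _ ->]]; rewrite memv_ker ppv.
- left; rewrite -[P]psiK -/p (_ : p = 0) //; apply/lfunP => v; rewrite lfunE /=.
  by apply/eqP; rewrite -memv0 -U0 memv_img ?memvf.
right; rewrite -[P]psiK -/p -phi1; congr phi; apply/lfunP => v; rewrite lfunE /=.
apply/esym/eqP; rewrite -subr_eq0 -memv0 -W0 memv_ker linearB /= ppv subrr.
by [].
Qed.

Lemma qrep_kQmodule n (E : vertex Q -> 'M[k]_n) (A : arrow Q -> 'M[k]_n) :
  qrep E A -> qindec E A ->
  exists2 N : kQmodule k Q, indecomposable N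
    & forall i, \dim (limg (modact N (idem i))) = \rank (E i).
Proof.
move=> EA [n0 ind].
have [F [lF FM F1 Fi Fa]] := pathalg_eval EA.
have [phi [psi [lphi psiK phiK phiM [phi1 phir]]]] :=
  @mx_lfun_iso k 'rV[k]_n n (mul1n n).
have lact : linear (psi \o F).
  move=> c x y; apply: (can_inj phiK); rewrite /= psiK lF lphi !psiK.
  by [].
pose al := GRing.isLinear.Build k (pathalg k Q) 'End('rV[k]_n) *:%R (psi \o F) lact.
pose act : {linear pathalg k Q -> 'End('rV[k]_n)} := HB.pack (psi \o F) al.
have act1 : act 1 = \1%VF by apply: (can_inj phiK); rewrite /= psiK F1 phi1.
have actM x y : act (x * y) = (act x \o act y)%VF.
  by apply: (can_inj phiK); rewrite phiM /= !psiK FM.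
pose N := KQModule act1 actM.
exists N; last by move=> i; rewrite phir /= psiK Fi.
split.
  move/eqP; rewrite -dimv_eq0 dimvf /= => /eqP.
  by rewrite [dim _]mul1n; lia.
move=> U W sU sW UW1 UW0.
pose p := daddv_pi U W.
have pw w : w \in W -> p w = 0.
  move=> wW; have := daddv_pi_add UW0 (w := w); rewrite UW1 memvf => /(_ isT).
  rewrite (daddv_pi_id (U := W)) //; last by rewrite capvC.
  by move/eqP; rewrite -subr_eq0 addrK => /eqP.
have pu u : u \in U -> p u = u by exact: daddv_pi_id.
have comm x v : p (act x v) = act x (p v).
  have /memv_addP[u uU [w wW ->]] : v \in (U + W)%VS by rewrite UW1 memvf.
  have aU : act x u \in U by apply: (subvP (sU x)); apply: memv_img.
  have aW : act x w \in W by apply: (subvP (sW x)); apply: memv_img.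
  by rewrite !linearD /= (pu _ uU) (pw _ wW) (pu _ aU) (pw _ aW) linear0.
have commx x : F x *m phi p = phi p *m F x.
  rewrite -[F x]psiK -!phiM; congr phi; apply/lfunP => v.
  by rewrite !lfunE /= -[psi (F x)]/(act x) comm.
have [||p0|p1] := ind (phi p).
- by split=> [i|a]; [rewrite -Fi | rewrite -Fa].
- by rewrite -phiM; congr phi; apply/lfunP => v; rewrite lfunE /= pu // memv_pi.
- left; apply/eqP; rewrite -subv0; apply/subvP => u uU; rewrite memv0 -(pu _ uU).
  have -> : p = 0 by apply: (can_inj phiK); rewrite p0 (linear_fun0 lphi).
  by rewrite lfunE.
right; apply/eqP; rewrite -subv0; apply/subvP => w wW; rewrite memv0 -(pw _ wW).
have -> : p = \1%VF by apply: (can_inj phiK); rewrite p1 phi1.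
by rewrite lfunE.
Qed.

End Modules.

(** * The Tits form of a Dynkin quiver *)

Section DynkinPositivity.
Import Order.TTheory Num.Theory.

Definition tits (Q : quiver) (x : vertex Q -> rat) : rat :=
  \sum_i x i ^+ 2 - \sum_a x (atail a) * x (ahead a).

(** The form of the chain 0 - ... - m in which the square of the end vertex carries the least weight
    that keeps it nonnegative; [armS] exhibits it as a sum of squares. *)
Definition arm (m : nat) (z : nat -> rat) : rat :=
  \sum_(i < m) (z i ^+ 2 - z i * z i.+1) + m%:R / (2 * m.+1%:R) * z m ^+ 2.

Lemma armS m z : arm m.+1 z =
  arm m z + m.+2%:R / (2 * m.+1%:R) * (z m - m.+1%:R / m.+2%:R * z m.+1) ^+ 2.
Proof.
rewrite /arm big_ord_recr /=.
have h : (m%:R + 1 : rat) != 0 by rewrite natr1 pnatr_eq0.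
have h' : (m%:R + 2 : rat) != 0 by rewrite -natrD pnatr_eq0 addnS.
rewrite -[m.+2%:R]natr1 -[m.+1%:R]natr1 -addrA.
set S := \sum_(i < m) _; field.
by rewrite -?addrA ?h ?h' /=.
Qed.

Lemma arm_ge0 m z : 0 <= arm m z.
Proof.
elim: m => [|m IH]; first by rewrite /arm big_ord0 mulr0n !mul0r addr0.
rewrite armS addr_ge0 // mulr_ge0 ?sqr_ge0 // divr_ge0 ?mulr_ge0 ?ler0n //.
Qed.

Lemma arm_eq0 m z : arm m z = 0 -> z m = 0 -> forall i, (i <= m)%N -> z i = 0.
Proof.
elim: m => [|m IH] a0 zm i; first by rewrite leqn0 => /eqP ->.
rewrite leq_eqVlt => /orP[/eqP -> //|im]; apply: IH => //.
  move/eqP: a0; rewrite armS paddr_eq0 ?arm_ge0 // => [/andP[/eqP //]|].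
  by rewrite mulr_ge0 ?sqr_ge0 // divr_ge0 ?mulr_ge0 ?ler0n.
move/eqP: a0; rewrite armS paddr_eq0 ?arm_ge0 // => [/andP[_]|]; last first.
  by rewrite mulr_ge0 ?sqr_ge0 // divr_ge0 ?mulr_ge0 ?ler0n.
rewrite zm mulr0 subr0 mulf_eq0 sqrf_eq0 => /orP[|/eqP //].
by rewrite mulf_eq0 invr_eq0 mulf_eq0 !pnatr_eq0.
Qed.

Definition edge_form n (e : rel nat) (z : nat -> rat) : rat :=
  \sum_(i < n) z i ^+ 2 - \sum_(i < n) \sum_(j < n) (e i j)%:R * (z i * z j).

Lemma linear_edgeE i j : linear_edge i j = (j == i.+1). Proof. by []. Qed.
Lemma branch_edgeE n b i j :
  branch_edge n b i j = if j.+1 == n then i == b else j == i.+1.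
Proof. by []. Qed.

(** Type A_n is an arm that ends in a fictitious vertex n with value 0. *)
Lemma linear_edge_form n z : z n = 0 -> edge_form n linear_edge z = arm n z.
Proof.
move=> zn; rewrite /edge_form /arm zn expr0n mulr0 addr0 -sumrB.
apply: eq_bigr => i _; congr (_ - _).
have [lt|ge] := ltnP i.+1 n.
  rewrite (bigD1 (Ordinal lt)) //= linear_edgeE eqxx mul1r big1 ?addr0 // => j ji.
  rewrite linear_edgeE [_ == _](_ : _ = false) ?mul0r //; apply/negbTE.
  by apply: contraNneq ji => e; apply/eqP/val_inj.
have e : i.+1 = n by apply/eqP; rewrite eqn_leq ge ltn_ord.
rewrite big1 ?e ?zn ?mulr0 // => j _ /=.
by rewrite linear_edgeE e (ltn_eqF (ltn_ord j)) mul0r.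
Qed.

(* Completing the squares along the three arms; the remaining coefficient of the
   square at the branch vertex is half of [1/(b+1) + 1/(r+1) + 1/2 - 1]. *)
Lemma branch_edge_form b r z : (0 < r)%N ->
  edge_form (b + r).+2 (branch_edge (b + r).+2 b) z =
  arm b z + arm r (fun i => z (b + r - i)%N) + arm 1 (fun i => if i is 0 then z (b + r).+1 else z b)
  + (1 - b%:R / (2 * b.+1%:R) - r%:R / (2 * r.+1%:R) - 1 / 4) * z b ^+ 2.
Proof.
move=> r0; rewrite /edge_form.
have -> : \sum_(i < (b + r).+2) \sum_(j < (b + r).+2)
     (branch_edge (b + r).+2 b i j)%:R * (z i * z j) =
   \sum_(i < b + r) z i * z i.+1 + z b * z (b + r).+1.
  rewrite exchange_big big_ord_recr /=; congr (_ + _).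
    rewrite big_ord_recl big1 ?add0r => [|i _]; last first.
      by rewrite branch_edgeE /= mul0r.
    apply: eq_bigr => j _.
    have lt : (j < (b + r).+2)%N by rewrite (ltn_trans (ltn_ord j)).
    rewrite (bigD1 (Ordinal lt)) //= branch_edgeE /bump /= add1n.
    rewrite !eqSS (ltn_eqF (ltn_ord j)) eqxx mul1r big1 ?addr0 // => i ij.
    rewrite branch_edgeE !eqSS (ltn_eqF (ltn_ord j)) [_ == _](_ : _ = false) ?mul0r //; apply/negbTE.
    by apply: contraNneq ij => e; apply/eqP/val_inj.
  have lt : (b < (b + r).+2)%N by lia.
  rewrite (bigD1 (Ordinal lt)) //= branch_edgeE !eqxx mul1r big1 ?addr0 // => i ij.
  rewrite branch_edgeE eqxx [_ == _](_ : _ = false) ?mul0r //; apply/negbTE.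
  by apply: contraNneq ij => e; apply/eqP/val_inj.
have sq : \sum_(i < (b + r).+2) z i ^+ 2 = \sum_(i < b) z i ^+ 2 + z b ^+ 2
    + \sum_(i < r) z (b + r - i)%N ^+ 2 + z (b + r).+1 ^+ 2.
  rewrite big_ord_recr /=; congr (_ + _).
  rewrite -(big_mkord xpredT (fun i => z i ^+ 2)) (big_cat_nat (n := b.+1)) ?leq_addr //=.
  rewrite big_nat_recr //= big_mkord; congr (_ + _).
  rewrite -{1}[b.+1]add0n big_addn (_ : (b + r).+1 - b.+1 = r)%N; last by lia.
  rewrite big_nat_rev /= big_mkord; apply: eq_bigr => i _; congr (z _ ^+ 2).
  by have := ltn_ord i; lia.
have pr : \sum_(i < b + r) z i * z i.+1 = \sum_(i < b) z i * z i.+1 +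
    \sum_(i < r) z (b + r - i)%N * z (b + r - i.+1)%N.
  rewrite -(big_mkord xpredT (fun i => z i * z i.+1)) (big_cat_nat (n := b)) ?leq_addr //=.
  rewrite big_mkord; congr (_ + _).
  rewrite -{1}[b]add0n big_addn (_ : b + r - b = r)%N; last by lia.
  rewrite big_nat_rev /= big_mkord; apply: eq_bigr => i _; rewrite mulrC.
  by have := ltn_ord i; move=> ?; congr (z _ * z _); lia.
rewrite sq pr /arm big_ord1 !sumrB (_ : b + r - r = b)%N; last by lia.
have h : (b%:R + 1 : rat) != 0 by rewrite natr1 pnatr_eq0.
have h' : (r%:R + 1 : rat) != 0 by rewrite natr1 pnatr_eq0.
rewrite -[b.+1%:R]natr1 -[r.+1%:R]natr1.
set s1 := \sum_(i < b) _; set s2 := \sum_(i < r) _.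
rewrite /=; set s3 := \sum_(i < b) z i * z i.+1.
set s4 := \sum_(i < r) z (b + r - i)%N * z (b + r - i.+1)%N.
by field; rewrite h h'.
Qed.

Lemma dynkin_edge_form n e z : dynkin_graph n e -> (forall i, (n <= i)%N -> z i = 0) ->
  (exists2 i, (i < n)%N & z i != 0) -> 0 < edge_form n e z.
Proof.
suff branch b r : (0 < r)%N ->
    (0 : rat) < 1 - b%:R / (2 * b.+1%:R) - r%:R / (2 * r.+1%:R) - 1 / 4 ->
    (exists2 i, (i < (b + r).+2)%N & z i != 0) ->
    0 < edge_form (b + r).+2 (branch_edge (b + r).+2 b) z.
  case=> {n e} n n0 zn [i li nz].
  - rewrite linear_edge_form ?zn // lt_def arm_ge0 andbT.
    by apply: contraNneq nz => a0; rewrite (arm_eq0 a0) ?zn // ltnW.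
  (* Type D has arms of lengths n - 3, 1 and 1, which leaves the coefficient 1/(2(n-2)) at the
     branch vertex. *)
  - have e : n = (n - 3 + 1).+2 by lia.
    have := branch (n - 3)%N 1%N isT; rewrite -e; apply; last by exists i.
    have h : (0 : rat) < (n - 3).+1%:R by rewrite ltr0n.
    have -> : (n - 3)%:R = (n - 3).+1%:R - 1 :> rat by rewrite -natr1 addrK.
    rewrite (_ : _ - _ - _ - _ = 1 / (2 * (n - 3).+1%:R)); first by rewrite divr_gt0 ?mulr_gt0.
    by field; rewrite addrC natr1 gt_eqF.
  (* Type E has arms of lengths 2, n - 4 and 1; the remaining coefficients for n = 6, 7, 8 are 1/12,
     1/24 and 1/60, and n = 9 would give 0. *)
  have e4 : n = (2 + (n - 4)).+2 by lia.
  have := branch 2%N (n - 4)%N; rewrite -e4; apply; [lia| | by exists i].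
  have : (n - 4 = 2 \/ n - 4 = 3 \/ n - 4 = 4)%N by lia.
  by case=> [->|[->|->]]; lra.
move=> r0 kpos [i li nz]; rewrite branch_edge_form //.
set c := (X in X * z b ^+ 2) in kpos *.
have sq : 0 <= c * z b ^+ 2 by rewrite mulr_ge0 ?sqr_ge0 // ltW.
have := arm_ge0 1 (fun i => if i is 0 then z (b + r).+1 else z b).
have := arm_ge0 r (fun i => z (b + r - i)%N); have := arm_ge0 b z.
case: ltP => // le p1 p2 p3.
have a1 : arm b z = 0 by lra.
have a2 : arm r (fun i => z (b + r - i)%N) = 0 by lra.
have a3 : arm 1 (fun i => if i is 0 then z (b + r).+1 else z b) = 0 by lra.
have /eqP : c * z b ^+ 2 = 0 by lra.
rewrite mulf_eq0 (gt_eqF kpos) /= sqrf_eq0 => /eqP zb.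
case/negP: nz; apply/eqP.
have [ib|bi] := leqP i b; first by rewrite (arm_eq0 a1).
have [ir|ri] := leqP i (b + r)%N.
  have := arm_eq0 a2 _ (i := (b + r - i)%N); rewrite subKn // => -> //; last by lia.
  by rewrite -zb; congr (z _); lia.
have -> : i = (b + r).+1 by lia.
by rewrite (arm_eq0 a3 _ (i := 0%N)).
Qed.

Lemma dynkin_graph_asym n e i j : dynkin_graph n e -> e i j -> e j i = false.
Proof.
case=> {n e} n n0; rewrite ?linear_edgeE ?branch_edgeE; first by lia.
  by case: (j.+1 =P n) => ?; case: (i.+1 =P n) => ?; lia.
by case: (j.+1 =P n) => ?; case: (i.+1 =P n) => ?; lia.
Qed.

Lemma dynkin_graph_irr n e i : dynkin_graph n e -> e i i = false.
Proof. by move=> ge; apply/negP => eii; have := dynkin_graph_asym ge eii; rewrite eii. Qed.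

Section DynkinForm.
Variables (Q : quiver).
Hypothesis dQ : dynkin Q.
Local Notation tits := (@tits Q).

Let beta (x y : vertex Q -> rat) : rat :=
  2 * (\sum_i x i * y i) - \sum_a (x (atail a) * y (ahead a) + y (atail a) * x (ahead a)).

(** An arrow between distinct vertices is counted for both orders of its ends, whence the factor 2;
    a loop would be counted once. *)
Lemma sum_nedges (x : vertex Q -> rat) : (forall i : vertex Q, nedges i i = 0%N :> nat) ->
  \sum_(i : vertex Q) \sum_(j : vertex Q) (nedges i j)%:R * (x i * x j) = 2 * \sum_a x (atail a) * x (ahead a).
Proof.
move=> loopless.
have ta (a : arrow Q) : atail a != ahead a.
  apply/eqP => e; have := loopless (atail a); rewrite /nedges => /eqP.
  by rewrite cards_eq0 => /eqP/setP/(_ a); rewrite !inE -e eqxx.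
have E (i j : vertex Q) : (nedges i j)%:R * (x i * x j) = \sum_a
    (((atail a == i) && (ahead a == j))%:R + ((atail a == j) && (ahead a == i))%:R) * (x i * x j).
  rewrite -mulr_suml /nedges; congr (_ * _).
  rewrite -sum1_card natr_sum big_mkcond /=; apply: eq_bigr => a _.
  rewrite inE; case: (altP (atail a =P i)) => [ai|_]; case: (altP (ahead a =P j)) => [aj|_] /=;
    rewrite ?andbF ?andbT ?orbF ?addr0 ?add0r //=.
    rewrite -aj -ai (negPf (ta a)) /= addr0 //.
  - by case: ifP; rewrite ?add0r ?addr0.
  - by case: ifP; rewrite ?add0r ?addr0.
  by case: ifP; rewrite ?add0r ?addr0.
under eq_bigr => i _ do (under eq_bigr => j _ do rewrite E; rewrite exchange_big).
rewrite exchange_big /= mulr_sumr.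
have D (u w : vertex Q) (f : vertex Q -> vertex Q -> rat) :
    \sum_i \sum_j ((u == i) && (w == j))%:R * f i j = f u w.
  rewrite (bigD1 u) //= (bigD1 w) //= !eqxx mul1r big1 => [|j jw].
    rewrite addr0 big1 ?addr0 // => i iu; rewrite big1 // => j _.
    by rewrite eq_sym (negPf iu) mul0r.
  by rewrite andTb eq_sym (negPf jw) mul0r.
apply: eq_bigr => a _.
under eq_bigr => i _ do (under eq_bigr => j _ do rewrite mulrDl; rewrite big_split).
rewrite big_split /= D.
rewrite exchange_big /= (D _ _ (fun j i => x i * x j)).
by rewrite mulrC -mulr2n mulr_natl mulrC.
Qed.

Lemma tits_gt0 x : (exists i, x i != 0) -> 0 < tits x.
Proof.
have [n [e [ge [f [g fK gK] fe]]]] := dQ.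
move=> [v xv].
pose z i : rat := if insub i is Some j then x (g j) else 0.
have zE (j : 'I_n) : z j = x (g j) by rewrite /z valK.
have ei i := dynkin_graph_irr i ge; have ee i j := @dynkin_graph_asym n e i j ge.
suff -> : tits x = edge_form n e z.
  apply: dynkin_edge_form ge _ _ => [i ni|]; first by rewrite /z insubF // ltnNge ni.
  by exists (f v) => //; rewrite zE fK.
have tits2 : 2 * tits x = 2 * edge_form n e z; last by apply: (mulfI _ tits2).
rewrite /tits /edge_form !mulrBr; congr (_ - _).
  by rewrite (reindex f) /=; [congr (_ * _); apply: eq_bigr => i _; rewrite zE fK | exists g => i _ ].
rewrite -sum_nedges => [|i]; last by rewrite fe ei.
transitivity (\sum_(i < n) \sum_(j < n) ((e i j)%:R + (e j i)%:R) * (z i * z j)).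
  rewrite [RHS](reindex f) /=; last by exists g => i _.
  apply: eq_bigr => i _; rewrite [RHS](reindex f) /=; last by exists g => j _.
  apply: eq_bigr => j _; rewrite fe !zE !fK; congr (_ * _).
  case: (boolP (e (f i) (f j))) => [/ee -> //|_] /=; by rewrite ?add0r ?addr0.
under eq_bigr => i _ do (under eq_bigr => j _ do rewrite mulrDl; rewrite big_split).
rewrite big_split /=.
rewrite [X in _ + X]exchange_big /= mulr2n mulrDl mul1r; congr (_ + _).
by apply: eq_bigr => i _; apply: eq_bigr => j _; rewrite [z j * _]mulrC.
Qed.

Lemma tits_natr (d : vertex Q -> nat) : tits (fun i => (d i)%:R) =
  (\sum_i d i * d i)%:R - (\sum_a d (atail a) * d (ahead a))%:R.
Proof.
by rewrite /tits !natr_sum; congr (_ - _); apply: eq_bigr => i _; rewrite natrM ?expr2.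
Qed.

Lemma dynkin_tits_positive : tits_positive Q.
Proof.
move=> d [i di]; rewrite -(ltr_nat rat) -subr_gt0 -tits_natr; apply: tits_gt0.
by exists i; rewrite pnatr_eq0.
Qed.

Let tits_add s x y : tits (fun i => x i + s * y i) = tits x + s * beta x y + s ^+ 2 * tits y.
Proof.
rewrite /tits /beta !mulrBr !mulr_sumr.
rewrite [X in X - _ = _](_ : _ = \sum_i x i ^+ 2 + \sum_i s * (2 * (x i * y i)) + \sum_i s ^+ 2 * y i ^+ 2).
  rewrite [X in _ - X = _](_ : _ = \sum_a x (atail a) * x (ahead a) +
     \sum_a s * (x (atail a) * y (ahead a) + y (atail a) * x (ahead a))
     + \sum_a s ^+ 2 * (y (atail a) * y (ahead a))).
    by rewrite -!mulr_sumr; ring.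
  by rewrite -!big_split; apply: eq_bigr => a _ /=; ring.
by rewrite -!big_split; apply: eq_bigr => a _ /=; ring.
Qed.

Let delta (j i : vertex Q) : rat := (i == j)%:R.

Let beta_lin c x y z : beta (fun i => c * x i + y i) z = c * beta x z + beta y z.
Proof.
rewrite /beta mulrBr addrACA -opprD; congr (_ - _).
  rewrite !mulr_sumr -big_split.
  by apply: eq_bigr => i _ /=; ring.
by rewrite mulr_sumr -big_split; apply: eq_bigr => a _ /=; ring.
Qed.

Let betaC x y : beta x y = beta y x.
Proof.
rewrite /beta; congr (_ * _ - _); first by apply: eq_bigr => i _; rewrite mulrC.
by apply: eq_bigr => a _; rewrite addrC.
Qed.

Let beta_diag x : beta x x = 2 * tits x.
Proof.
rewrite /beta /tits mulrBr; congr (_ * _ - _).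
by rewrite mulr_sumr; apply: eq_bigr => a _; ring.
Qed.

(** Positive definiteness makes the polar form [beta] nondegenerate, so it represents every
    coordinate function. This prepares a Cauchy-Schwarz bound of each coordinate by [tits]. *)
Lemma tits_dual j : exists w, forall x, beta w x = x j.
Proof.
pose N := #|vertex Q|.
pose fn (u : 'rV[rat]_N) (i : vertex Q) : rat := u 0 (enum_rank i).
have fnZ c u v : fn (c *: u + v) = fun i => c * fn u i + fn v i.
  by apply/funext => i; rewrite /fn !mxE.
have exp y x : beta y x = \sum_(l < N) x (enum_val l) * beta y (delta (enum_val l)).
  have -> : beta y x = beta y (fn (\row_l x (enum_val l))).
    by congr beta; apply/funext => i; rewrite /fn mxE enum_rankK.
  rewrite (linear_rV_sum (f := fun u => beta y (fn u))) => [|c u v].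
    apply: eq_bigr => l _; rewrite mxE; congr (_ * beta _ _).
    apply/funext => i; rewrite /fn /delta mxE eqxx /= -(inj_eq enum_val_inj) enum_rankK.
    by [].
  by rewrite fnZ betaC beta_lin !(betaC _ y).
have [|D HD] := @linear_mxE rat N N (fun u => \row_l beta (fn u) (delta (enum_val l))).
  by move=> c u v; apply/rowP => l; rewrite !mxE fnZ beta_lin.
have uD : D \in unitmx.
  rewrite -row_free_unit -kermx_eq0; apply/rowV0P => u /sub_kermxP.
  rewrite HD => /rowP u0.
  have : beta (fn u) (fn u) = 0.
    by rewrite exp big1 // => l _; have := u0 l; rewrite !mxE => ->; rewrite mulr0.
  rewrite beta_diag => t0; apply/rowP => l; rewrite mxE.
  apply/eqP/negPn/negP => ul; have := @tits_gt0 (fn u).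
  move/eqP: t0; rewrite mulf_eq0 /= => /eqP ->; rewrite ltxx => h.
  by suff : false by []; apply: h; exists (enum_val l); rewrite /fn enum_valK.
exists (fn (delta_mx 0 (enum_rank j) *m invmx D)) => x.
have := HD (delta_mx 0 (enum_rank j) *m invmx D).
rewrite mulmxKV // => /rowP HE.
rewrite exp (bigD1 (enum_rank j)) //= big1 => [|l lj].
  by have := HE (enum_rank j); rewrite !mxE !eqxx enum_rankK => <-; rewrite mulr1 addr0.
by have := HE l; rewrite !mxE (negPf lj) andbF => <-; rewrite mulr0.
Qed.

(** Cauchy-Schwarz gives (x j)^2 <= b j * tits x, and the assumption is tits x <= x i0. At j = i0
    this bounds x i0 by b i0, hence tits x, and then every coordinate. *)
Lemma tits_bound : exists C, forall (d : vertex Q -> nat) i0,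
  (\sum_i d i * d i <= \sum_(a : arrow Q) d (atail a) * d (ahead a) + d i0)%N ->
  (\sum_i d i <= C)%N.
Proof.
have [w Hw] : exists w : vertex Q -> vertex Q -> rat, forall j x, beta (w j) x = x j.
  exists (fun j => sval (cid (tits_dual j))) => j; by case: cid.
pose c j := tits (w j).
have c0 j : 0 < c j.
  apply: tits_gt0; apply/not_existsP => h.
  have w0 i : w j i = 0 by apply/eqP/negPn/negP; exact: h.
  have := Hw j (delta j); rewrite /delta eqxx /beta !big1.
  - by rewrite mulr0 subrr => /eqP; rewrite eq_sym oner_eq0.
  - by move=> a _; rewrite !w0 mul0r mulr0 addr0.
  by move=> i _; rewrite w0 mul0r.
have tits_ge0 x : 0 <= tits x.
  have [/tits_gt0/ltW //|/forallNP x0] := pselect (exists i, x i != 0).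
  have x0' i : x i = 0 by apply/eqP/negPn/negP; exact: x0.
  by rewrite /tits !big1 ?subrr // => [a|i] _; rewrite !x0' ?expr0n ?mul0r.
have [b [b0 CS]] : exists b, (forall j, 0 < b j) /\
    forall j x, x j ^+ 2 <= b j * tits x.
  exists (fun j => 4 * c j); split=> [j|j x]; first exact: mulr_gt0.
  (* The multiple of [w j] at which tits (x + s w) = tits x + s x_j + s^2 c_j is smallest. *)
  have := tits_ge0 (fun i => x i + (- (x j / (2 * c j))) * w j i).
  rewrite tits_add betaC Hw -/(c j) => h.
  have cj := c0 j; have e : c j != 0 by rewrite gt_eqF.
  rewrite -subr_ge0.
  rewrite (_ : _ - _ = 4 * c j *
     (tits x + - (x j / (2 * c j)) * x j + (- (x j / (2 * c j))) ^+ 2 * c j)).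
    by rewrite mulr_ge0 // mulr_ge0 // ltW.
  by field.
pose K := \sum_i \sum_j b i * b j.
have bb0 i j : 0 <= b i * b j by rewrite mulr_ge0 // ltW.
have K0 : 0 <= K by apply: sumr_ge0 => i _; apply: sumr_ge0.
exists (Num.bound K) => d i0 hd.
pose x i : rat := (d i)%:R.
have tx : tits x <= x i0.
  by rewrite tits_natr lerBlDl -natrD ler_nat.
have xi0 : x i0 <= b i0.
  have [z|nz] := eqVneq (x i0) 0; first by rewrite z ltW.
  have xp : 0 < x i0 by rewrite lt_def nz ler0n.
  rewrite -(ler_pM2r xp) -expr2; apply: le_trans (CS i0 x) _.
  by rewrite ler_pM2l.
(* Integrality enters here: a natural number is at most its square. *)
have xj j : x j <= b j * b i0.
  apply: (@le_trans _ _ (x j ^+ 2)).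
    by rewrite /x -natrX ler_nat; case: (d j) => // m; rewrite expnS leq_pmulr ?expn_gt0.
  apply: le_trans (CS j x) _.
  by rewrite ler_pM2l //; apply: le_trans tx xi0.
have : \sum_i x i <= K.
  apply: ler_sum => i _; apply: le_trans (xj i) _; rewrite (bigD1 i0) //= lerDl.
  exact: sumr_ge0.
move=> /le_lt_trans/(_ (archi_boundP K0)); rewrite -natr_sum ltr_nat; exact: ltnW.
Qed.

End DynkinForm.

End DynkinPositivity.

(** * Finite generation over k[z] *)

Section SeqSpan.
Variables (R : comNzRingType) (V : lmodType R) (s : seq V).

Definition seqspan (x : V) := exists c : nat -> R, x = \sum_(j < size s) c j *: s`_j.

Lemma seqspan0 : seqspan 0.
Proof. by exists (fun _ => 0); rewrite big1 // => j _; rewrite scale0r. Qed.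

Lemma seqspanD x y : seqspan x -> seqspan y -> seqspan (x + y).
Proof.
move=> [c ->] [d ->]; exists (fun j => c j + d j).
by rewrite -big_split; apply: eq_bigr => j _; rewrite scalerDl.
Qed.

Lemma seqspanZ a x : seqspan x -> seqspan (a *: x).
Proof.
move=> [c ->]; exists (fun j => a * c j).
by rewrite scaler_sumr; apply: eq_bigr => j _; rewrite scalerA.
Qed.

Lemma seqspan_sum I (r : seq I) (F : I -> V) :
  (forall i, seqspan (F i)) -> seqspan (\sum_(i <- r) F i).
Proof. by move=> h; apply: (big_ind seqspan) => //; [exact: seqspan0 | exact: seqspanD]. Qed.

Lemma seqspan_mem x : x \in s -> seqspan x.
Proof.
move=> xs; exists (fun j => (j == index x s)%:R).
have lt : (index x s < size s)%N by rewrite index_mem.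
rewrite (bigD1 (Ordinal lt)) //= eqxx scale1r nth_index // big1 ?addr0 // => j.
by rewrite -val_eqE /= => /negPf ->; rewrite scale0r.
Qed.

End SeqSpan.

Section FiniteCodimension.
Variables (k : fieldType) (V : lmodType k) (W : V -> Prop).
Hypotheses (W0 : W 0) (WD : forall x y, W x -> W y -> W (x + y))
  (WZ : forall c x, W x -> W (c *: x)).

Let WN x : W x -> W (- x). Proof. by rewrite -scaleN1r; exact: WZ. Qed.

(** Coordinates on V / W without forming the quotient: a family of minimal length that generates
    modulo W is a basis modulo W, since a nontrivial relation would allow one member to be
    dropped. *)
Lemma fincodim_coord (s : seq V) :
  (forall x, exists2 y, seqspan s y & W (x - y)) ->
  exists n (f : V -> 'rV[k]_n),
    [/\ linear f, forall y, exists x, f x = y & forall x, f x = 0 <-> W x].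
Proof.
pose gen n (t : 'I_n -> V) := forall x, exists c : 'I_n -> k, W (x - \sum_j c j *: t j).
move=> hs.
have ex : exists n, `[< exists t : 'I_n -> V, gen n t >].
  exists (size s); apply/asboolP; exists (fun j => s`_j) => x.
  by have [y [c ->] Wxy] := hs x; exists c.
case: (ex_minnP ex) => n /asboolP[t gt] min.
have indep (c : 'I_n -> k) : W (\sum_j c j *: t j) -> forall j, c j = 0.
  move=> Wc l; apply/eqP/negPn/negP => cl.
  case: n t gt min c Wc l cl => [|n] t gt min c Wc l cl; first by case: l cl.
  suff : (n.+1 <= n)%N by rewrite ltnn.
  apply: min; apply/asboolP; exists (fun j => t (lift l j)) => x.
  have [b Wb] := gt x; exists (fun j => b (lift l j) - b l / c l * c (lift l j)).
  have := WD Wb (WZ (b l / c l) Wc).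
  congr W; rewrite -addrA; congr (_ + _).
  rewrite (bigD1_ord l) //= [in X in _ + X](bigD1_ord l) //=.
  rewrite scalerDr scalerA divfK // opprD addrACA addNr add0r scaler_sumr.
  rewrite -sumrN -big_split -sumrN; apply: eq_bigr => j _ /=.
  by rewrite scalerBl opprB scalerA addrC.
pose f x := \row_j sval (cid (gt x)) j.
have fP x : W (x - \sum_j f x 0 j *: t j).
  rewrite /f; case: cid => c /= h; move: h; congr (W (_ - _)).
  by apply: eq_bigr => j _; rewrite mxE.
have funiq x (u : 'rV_n) : W (x - \sum_j u 0 j *: t j) -> f x = u.
  move=> h; apply/rowP => j; apply/eqP; rewrite -subr_eq0; apply/eqP.
  apply: (indep (fun j => f x 0 j - u 0 j)).
  have := WD h (WN (fP x)); congr W.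
  rewrite opprB addrCA addrAC subrr add0r -sumrB.
  by apply: eq_bigr => i _; rewrite scalerBl.
exists n, f; split.
- move=> c x y; apply: funiq; have := WD (WZ c (fP x)) (fP y); congr W.
  rewrite scalerBr addrACA -opprD; congr (_ - _).
  by rewrite scaler_sumr -big_split; apply: eq_bigr => j _; rewrite !mxE scalerDl scalerA.
- move=> u; exists (\sum_j u 0 j *: t j); apply: funiq; by rewrite subrr.
move=> x; split=> [fx|Wx].
  by have := fP x; rewrite fx big1 ?subr0 // => j _; rewrite mxE scale0r.
by apply: funiq; rewrite big1 ?subr0 // => j _; rewrite mxE scale0r.
Qed.

Lemma fincodim_mx n (f : V -> 'rV[k]_n) (g : V -> V) :
  linear f -> (forall y, exists x, f x = y) -> (forall x, f x = 0 <-> W x) ->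
  linear g -> (forall x, W x -> W (g x)) ->
  exists M : 'M[k]_n, forall x, f (g x) = f x *m M.
Proof.
move=> lf sf kf lg Wg.
have [h hf] : exists h : 'rV_n -> V, forall y, f (h y) = y.
  by exists (fun y => sval (cid (sf y))) => y; case: cid.
have fB x y : f (x - y) = f x - f y.
  by have := lf (-1) y x; rewrite !scaleN1r ![- _ + _]addrC.
have gB x y : g (x - y) = g x - g y.
  by have := lg (-1) y x; rewrite !scaleN1r ![- _ + _]addrC.
have key x y : f x = f y -> f (g x) = f (g y).
  move=> e; apply/eqP; rewrite -subr_eq0 -fB -gB; apply/eqP/kf/Wg/kf.
  by rewrite fB e subrr.
have [|M HM] := @linear_mxE k n n (fun u => f (g (h u))).
  move=> c u v; rewrite -lf -lg; apply: key; by rewrite lf !hf.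
by exists M => x; rewrite HM; apply: key; rewrite hf.
Qed.

End FiniteCodimension.

(** * Path length as a grading, and nilpotency of the preprojective algebra *)

Section Grading.
Variables (R : comNzRingType) (Q : quiver).
Local Notation A := (pathalg R Q).

Definition hcomp (d : nat) : A -> A :=
  plift (fun p => if size (pseq p) == d then pbasis p else 0).
Lemma hcomp_linear d : linear (hcomp d). Proof. exact: plift_linear. Qed.
HB.instance Definition _ d := GRing.isLinear.Build R A A *:%R (hcomp d) (hcomp_linear d).

Lemma hcomp0 d : hcomp d 0 = 0. Proof. exact: linear0. Qed.
Lemma hcompD d x y : hcomp d (x + y) = hcomp d x + hcomp d y.
Proof. exact: (linearD (hcomp d)). Qed.
Lemma hcompZ d c x : hcomp d (c *: x) = c *: hcomp d x.
Proof. exact: (linearZ_LR (hcomp d)). Qed.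

Lemma hcomp_basis d p : hcomp d (pbasis p) = if size (pseq p) == d then pbasis p else 0.
Proof. exact: plift_basis. Qed.

Lemma pbmul_size (p q r : qpath Q) : Defs.pcomp p q = Some r ->
  size (pseq r) = (size (pseq p) + size (pseq q))%N.
Proof. by move=> /pcompP[_ _ ->]; rewrite size_cat. Qed.

Lemma hcompM_basisr d e q x : size (pseq q) = e ->
  hcomp (d + e) (x * pbasis q) = hcomp d x * pbasis q.
Proof.
move=> qe; elim/pathalg_basis_ind: x => [|x y hx hy|c x hx|p].
- by rewrite mul0r !hcomp0 mul0r.
- by rewrite mulrDl !hcompD mulrDl hx hy.
- by rewrite -pathalg_scalerAl !hcompZ hx pathalg_scalerAl.
rewrite pbasisM hcomp_basis /pbmul; case E: Defs.pcomp => [r|].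
  rewrite hcomp_basis (pbmul_size E) qe eqn_add2r; case: eqP => _; last by rewrite mul0r.
  by rewrite pbasisM /pbmul E.
by rewrite hcomp0; case: eqP => _; rewrite ?mul0r // pbasisM /pbmul E.
Qed.

Lemma hcompM_basisr_lt d e q x : size (pseq q) = e -> (d < e)%N ->
  hcomp d (x * pbasis q) = 0.
Proof.
move=> qe de; elim/pathalg_basis_ind: x => [|x y hx hy|c x hx|p].
- by rewrite mul0r !hcomp0.
- by rewrite mulrDl !hcompD hx hy addr0.
- by rewrite -pathalg_scalerAl !hcompZ hx scaler0.
rewrite pbasisM /pbmul; case E: Defs.pcomp => [r|]; last by rewrite hcomp0.
by rewrite hcomp_basis (pbmul_size E) qe; case: eqP => //; lia.
Qed.

Lemma hcomp_idemMl d i x : hcomp d (idem i * x) = idem i * hcomp d x.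
Proof.
elim/pathalg_basis_ind: x => [|x y hx hy|c x hx|p].
- by rewrite mulr0 !hcomp0 mulr0.
- by rewrite mulrDr !hcompD mulrDr hx hy.
- by rewrite -pathalg_scalerAr !hcompZ hx pathalg_scalerAr.
rewrite pbasisM hcomp_basis /pbmul; case E: Defs.pcomp => [r|].
  rewrite hcomp_basis (pbmul_size E) add0n; case: eqP => _; last by rewrite mulr0.
  by rewrite pbasisM /pbmul E.
by rewrite hcomp0; case: eqP => _; rewrite ?mulr0 // pbasisM /pbmul E.
Qed.

Definition paths_lt L : seq (qpath Q) :=
  pmap insub (allpairs pair (enum (vertex Q))
    (flatten [seq [seq val t | t <- enum {: d.-tuple (arrow Q)}] | d <- iota 0 L])).

Lemma mem_paths_lt L p : (size (pseq p) < L)%N -> p \in paths_lt L.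
Proof.
move=> pL; rewrite /paths_lt mem_pmap_sub.
have -> : val p = (psrc p, pseq p) := surjective_pairing _.
apply: allpairs_f; first by rewrite mem_enum.
apply/flattenP; exists [seq val t | t <- enum {: (size (pseq p)).-tuple (arrow Q)}].
  by apply/mapP; exists (size (pseq p)); rewrite // mem_iota add0n.
by apply/mapP; exists (in_tuple (pseq p)); rewrite ?mem_enum.
Qed.

End Grading.

Section Preprojective.
Variables (k : fieldType) (Q : quiver).
Local Notation DQ := (double_quiver Q).
Local Notation A := (pathalg k DQ).
Local Notation orig a := (arr (inl a : arrow DQ) : A).
Local Notation star a := (arr (inr a : arrow DQ) : A).

Definition prho (i : vertex Q) : A :=
  \sum_(a : arrow Q | atail a == i) orig a * star a
  - \sum_(a : arrow Q | ahead a == i) star a * orig a.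

(* The degree [d] part of the ideal generated by the [prho i]. *)
Inductive hrel : nat -> A -> Prop :=
| hrel_rho i : hrel 2 (prho i)
| hrel0 d : hrel d 0
| hrelD d x y of hrel d x & hrel d y : hrel d (x + y)
| hrelZ d c x of hrel d x : hrel d (c *: x)
| hrelMl d p x of hrel d x : hrel (size (pseq p) + d) (pbasis p * x)
| hrelMr d p x of hrel d x : hrel (d + size (pseq p)) (x * pbasis p).

Lemma sum_prho : \sum_i prho i = \sum_(a : arrow Q) (orig a * star a - star a * orig a).
Proof.
rewrite !sumrB; congr (_ - _).
  by rewrite [RHS](partition_big (fun a : arrow Q => atail a) xpredT).
by rewrite [RHS](partition_big (fun a : arrow Q => ahead a) xpredT).
Qed.

Let hcompM_arr d (x : A) (b : arrow DQ) : hcomp d.+1 (x * arr b) = hcomp d x * arr b.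
Proof. by rewrite -[d.+1]addn1 (@hcompM_basisr _ _ d 1). Qed.

Let hcompM_arr0 (x : A) (b : arrow DQ) : hcomp 0 (x * arr b) = 0.
Proof. exact: (@hcompM_basisr_lt _ _ 0 1). Qed.

Let hcomp_sum d I (r : seq I) P (F : I -> A) :
  hcomp d (\sum_(i <- r | P i) F i) = \sum_(i <- r | P i) hcomp d (F i).
Proof. exact: (linear_sum (hcomp d)). Qed.

Let hcompB d (x y : A) : hcomp d (x - y) = hcomp d x - hcomp d y.
Proof. exact: (linearB (hcomp d)). Qed.

Let hrel_hcompMl d y i : hrel (d + 2) (hcomp d y * prho i).
Proof.
elim/pathalg_basis_ind: y => [|x y hx hy|c x hx|p].
- by rewrite hcomp0 mul0r; exact: hrel0.
- by rewrite hcompD mulrDl; exact: hrelD.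
- by rewrite hcompZ -pathalg_scalerAl; exact: hrelZ.
rewrite hcomp_basis; case: eqP => [<-|_]; last by rewrite mul0r; exact: hrel0.
by apply: hrelMl; exact: hrel_rho.
Qed.

Let hrel_hcomp_prho d x i : hrel d (hcomp d (x * prho i)).
Proof.
rewrite /prho mulrBr !mulr_sumr hcompB !hcomp_sum.
case: d => [|[|d]].
- by rewrite !big1 ?subrr => [|a _|a _]; rewrite ?mulrA ?hcompM_arr0 //; exact: hrel0.
- rewrite !big1 ?subrr => [|a _|a _]; rewrite ?mulrA ?hcompM_arr ?hcompM_arr0 ?mul0r //.
  exact: hrel0.
have := hrel_hcompMl d x i; rewrite addn2 /prho mulrBr !mulr_sumr.
congr (hrel _ (_ - _)); apply: eq_bigr => a _.
  by rewrite !mulrA !hcompM_arr.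
by rewrite !mulrA !hcompM_arr.
Qed.

Hypothesis dQ : dynkin Q.

(* [e_i Pi / (degree >= L)] is a cyclic module over the preprojective algebra
   [Pi], so its dimension is bounded independently of [L]; hence some degree
   below a fixed bound vanishes. *)
Lemma preprojective_nilpotent : exists L, forall i, exists2 d, (d < L)%N &
  forall p : qpath DQ, psrc p = i -> size (pseq p) = d -> hrel d (pbasis p).
Proof.
have [C HC] := tits_bound dQ.
exists C.+1 => i; apply: contrapT => no.
have ex d : exists p : qpath DQ, (d < C.+1)%N ->
    [/\ psrc p = i, size (pseq p) = d & ~ hrel d (pbasis p)].
  apply: contrapT => h; case: (ltnP d C.+1) => dC; last first.
    by apply: h; exists (ptriv i) => dC'; move: dC; rewrite leqNgt dC'.
  apply: no; exists d => // p pi pd; apply: contrapT => nh.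
  by apply: h; exists p.
pose P d := sval (cid (ex d)).
have PP d : (d < C.+1)%N -> [/\ psrc (P d) = i, size (pseq (P d)) = d & ~ hrel d (pbasis (P d))].
  by rewrite /P; case: cid.
(* The path algebra modulo [W] is e_i Pi truncated to degrees at most C, with its right action; the
   class of 1 generates it. *)
pose W (x : A) := forall d, (d < C.+1)%N -> hrel d (hcomp d (idem i * x)).
have W0 : W 0 by move=> d _; rewrite mulr0 hcomp0; exact: hrel0.
have WD x y : W x -> W y -> W (x + y).
  by move=> wx wy d dC; rewrite mulrDr hcompD; apply: hrelD; [exact: wx|exact: wy].
have WZ c x : W x -> W (c *: x).
  by move=> wx d dC; rewrite -pathalg_scalerAr hcompZ; apply: hrelZ; exact: wx.
have Wrho x j : W (x * prho j) by move=> d dC; rewrite mulrA; exact: hrel_hcomp_prho.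
have Widem x j : W x -> W (x * idem j).
  move=> wx d dC; rewrite mulrA -[d]addn0 (@hcompM_basisr _ _ d 0) //.
  exact: (hrelMr (ptriv j) (wx d dC)).
have Warr x b : W x -> W (x * arr b).
  move=> wx [|d] dC; rewrite mulrA; first by rewrite hcompM_arr0; exact: hrel0.
  rewrite hcompM_arr -addn1; apply: (hrelMr (parrow b) (wx d _)); exact: ltnW.
have [|n [f [lf sf kf]]] := fincodim_coord W0 WD WZ (s := [seq pbasis p | p <- paths_lt DQ C.+1]).
  elim/pathalg_basis_ind=> [|x y [x' sx wx] [y' sy wy]|c x [x' sx wx]|p].
  - by exists 0; [exact: seqspan0 | rewrite subrr].
  - by exists (x' + y'); [exact: seqspanD | rewrite opprD addrACA; exact: WD].
  - by exists (c *: x'); [exact: seqspanZ | rewrite -scalerBr; exact: WZ].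
  have [pC|pC] := ltnP (size (pseq p)) C.+1.
    exists (pbasis p); last by rewrite subrr.
    by apply: seqspan_mem; apply: map_f; exact: mem_paths_lt.
  exists 0; first exact: seqspan0.
  move=> d dC; rewrite subr0 hcomp_idemMl hcomp_basis; case: eqP => [e|_].
    by move: dC; rewrite -e ltnNge pC.
  by rewrite mulr0; exact: hrel0.
have op (g : A) : (forall x, W x -> W (x * g)) -> exists M : 'M[k]_n, forall x, f (x * g) = f x *m M.
  move=> Wg; have lg : linear (fun x : A => x * g).
    by move=> c x y; rewrite mulrDl pathalg_scalerAl.
  exact: (fincodim_mx lf sf kf lg Wg).
have [E HE] : exists E : vertex DQ -> 'M[k]_n, forall j x, f (x * idem j) = f x *m E j.
  by exists (fun j => sval (cid (op _ (fun x => @Widem x j)))) => j; case: cid.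
have [B HB] : exists B : arrow DQ -> 'M[k]_n, forall b x, f (x * arr b) = f x *m B b.
  by exists (fun b => sval (cid (op _ (fun x => @Warr x b)))) => b; case: cid.
have mx_ext m (M M' : 'M[k]_(n, m)) : (forall x, f x *m M = f x *m M') -> M = M'.
  by move=> h; apply/row_matrixP => l; have [x Hx] := sf (delta_mx 0 l); rewrite !rowE -Hx.
have f0 : f 0 = 0 by apply/kf.
have fD x y : f (x + y) = f x + f y by have := lf 1 x y; rewrite !scale1r.
have fN x : f (- x) = - f x by have := lf (-1) x 0; rewrite !scaleN1r f0 !addr0.
have fsum I (r : seq I) (F : I -> A) : f (\sum_(a <- r) F a) = \sum_(a <- r) f (F a).
  exact: big_morph.
have [ii ij i1 ta ha] := pathalg_idemP k DQ.
have EB : qrep E B.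
  split=> [j|j l jl||b|b]; apply: mx_ext => x.
  - by rewrite mulmxA -!HE -mulrA ii.
  - by rewrite mulmxA -!HE -mulrA ij // mulr0 f0 mulmx0.
  - rewrite mulmx1 mulmx_sumr -[in RHS](mulr1 x) -i1 mulr_sumr fsum.
    by apply: eq_bigr => j _; rewrite HE.
  - by rewrite mulmxA -HE -!HB -mulrA ta.
  - by rewrite mulmxA -!HB -HE -mulrA ha.
have rho0 : \sum_(a : arrow Q) (B (inl a) *m B (inr a) - B (inr a) *m B (inl a)) = 0.
  apply: mx_ext => x; rewrite mulmx0.
  have -> : 0 = f (x * \sum_j prho j).
    by rewrite mulr_sumr fsum big1 // => j _; apply/kf.
  rewrite sum_prho mulr_sumr fsum mulmx_sumr; apply: eq_bigr => a _.
  by rewrite mulrBr fD fN mulmxBr !mulmxA !mulrA -!HB.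
have genE : f 1 *m E i = f 1.
  rewrite -HE mul1r; apply/eqP; rewrite -subr_eq0 -fN -fD; apply/eqP/kf => d dC.
  by rewrite mulrBr ii mulr1 subrr hcomp0; exact: hrel0.
(* Right multiplication by any element is a polynomial in the [E j] and [B b], so a commuting [H] is
   determined by its value on the generator. *)
have geninj H : graded E H -> (forall b, B b *m H = H *m B b) -> f 1 *m H = 0 -> H = 0.
  move=> gH cH gen0; apply: mx_ext => x; rewrite mulmx0.
  have [X XP XH] : exists2 X : 'M[k]_n, forall y, f (y * x) = f y *m X & X *m H = H *m X.
    elim/pathalg_ind: x => [|x y [X X1 X2] [Y Y1 Y2]|c x [X X1 X2]|x y [X X1 X2] [Y Y1 Y2]|j|b].
    - by exists 0 => [y|]; rewrite ?mulr0 ?f0 ?mulmx0 ?mul0mx.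
    - by exists (X + Y) => [z|]; rewrite ?mulrDr ?fD ?mulmxDr ?X1 ?Y1 ?mulmxDl ?X2 ?Y2.
    - exists (c *: X) => [z|]; last by rewrite -scalemxAl -scalemxAr X2.
      by rewrite -pathalg_scalerAr -[_ *: _]addr0 lf f0 addr0 X1 scalemxAr.
    - exists (X *m Y) => [z|]; first by rewrite mulrA Y1 X1 mulmxA.
      by rewrite -mulmxA Y2 mulmxA X2 mulmxA.
    - by exists (E j).
    - by exists (B b).
  by rewrite -[x]mul1r XP -mulmxA XH mulmxA gen0 mul0mx.
have nC : (n <= C)%N.
  have /HC := cyclic_preprojective_bound EB rho0 genE geninj.
  apply: leq_trans.
  rewrite -[X in (X <= _)%N](mxrank1 k n) -(qrepE1 EB).
  by apply: (big_rec2 (fun (X : 'M[k]_n) m => \rank X <= m)%N); [rewrite mxrank0|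
     move=> j X m _ h; apply: leq_trans (mxrank_add _ _) _; rewrite leq_add2l].
(* One path of nonzero class in each degree 0, ..., C: being homogeneous of distinct degrees they
   are independent modulo [W], one more than the dimension n <= C allows. *)
pose M : 'M[k]_(C.+1, n) := \matrix_l f (pbasis (P l)).
suff : row_free M by move=> /eqP fM; have := rank_leq_col M; rewrite fM; lia.
rewrite -kermx_eq0; apply/rowV0P => u /sub_kermxP uM.
have : f (\sum_l u 0 l *: pbasis (P l)) = 0.
  rewrite fsum -[RHS]uM mulmx_sum_row; apply: eq_bigr => l _.
  by rewrite rowK -[_ *: pbasis _]addr0 lf f0 addr0.
move=> /kf Wu; apply/rowP => d; rewrite mxE; apply/eqP/negPn/negP => ud.
have [ps pd nh] := PP d (ltn_ord d).
apply: nh; have := hrelZ (u 0 d)^-1 (Wu d (ltn_ord d)).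
rewrite mulr_sumr hcomp_sum (bigD1 d) //= big1 => [|l ld].
  rewrite addr0 -pathalg_scalerAr hcompZ scalerA mulVf // scale1r hcomp_idemMl hcomp_basis pd eqxx.
  have -> //: idem i * pbasis (P d) = pbasis (P d) :> A.
  rewrite pbasisM /pbmul (_ : Defs.pcomp _ _ = Some (P d)) //; apply/pcompP; split=> //.
rewrite -pathalg_scalerAr hcompZ hcomp_idemMl hcomp_basis.
have [_ -> _] := PP l (ltn_ord l).
by rewrite (inj_eq val_inj) (negPf ld) mulr0 scaler0.
Qed.

End Preprojective.

(** * The Heisenberg algebra as a k[z]-module *)

Section HeisenbergOverPoly.
Variables (k : fieldType) (Q : quiver) (v : {ffun vertex Q -> k}).
Local Notation DQ := (double_quiver Q).
Local Notation kzQ := (pathalg {poly k} DQ).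
Local Notation J := (heisenberg_rel v).

(* An alias, since [heisenberg v] already carries its [k]-module structure. *)
Definition zheis : Type := heisenberg v.
HB.instance Definition _ := GRing.PzRing.on zheis.

Definition zpi (w : kzQ) : zheis := qpi J w.

Lemma zpiD x y : zpi (x + y) = zpi x + zpi y. Proof. exact: (raddfD (qpi J)). Qed.
Lemma zpiN x : zpi (- x) = - zpi x. Proof. exact: (raddfN (qpi J)). Qed.
Lemma zpi0 : zpi 0 = 0. Proof. exact: (raddf0 (qpi J)). Qed.
Lemma zpiM x y : zpi (x * y) = zpi x * zpi y. Proof. exact: qpiM. Qed.
Lemma zpi1 : zpi 1 = 1. Proof. exact: (rmorph1 (qpi J)). Qed.
Lemma zpi_surj y : exists w, zpi w = y.
Proof. by exists (generic_quotient.repr y); exact: generic_quotient.reprK. Qed.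

Let zscale (c : {poly k}) (x : zheis) : zheis := zpi (c *: (1 : kzQ)) * x.
Let zscaleA a b x : zscale a (zscale b x) = zscale (a * b) x.
Proof. by rewrite /zscale mulrA -zpiM -pathalg_scalerAl mul1r scalerA. Qed.
Let zscale1 : left_id 1 zscale.
Proof. by move=> x; rewrite /zscale scale1r zpi1 mul1r. Qed.
Let zscaleDr : right_distributive zscale +%R.
Proof. by move=> c x y; rewrite /zscale mulrDr. Qed.
Let zscaleDl x : {morph zscale^~ x : a b / a + b}.
Proof. by move=> a b; rewrite /zscale scalerDl zpiD mulrDl. Qed.
HB.instance Definition _ := GRing.Zmodule_isLmodule.Build {poly k} zheis
  zscaleA zscale1 zscaleDr zscaleDl.

Lemma zpiZ c w : zpi (c *: w) = c *: zpi w.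
Proof. by rewrite -[in LHS](mul1r w) pathalg_scalerAl zpiM. Qed.

Lemma zscalerAl c (x y : zheis) : c *: (x * y) = (c *: x) * y.
Proof. exact: (mulrA (zpi (c *: (1 : kzQ)))). Qed.

Lemma zscalerAr c (x y : zheis) : c *: (x * y) = x * (c *: y).
Proof.
have [w <-] := zpi_surj x; have [u <-] := zpi_surj y.
by rewrite -zpiM -!zpiZ -zpiM pathalg_scalerAr.
Qed.

Lemma heis_scaleE (c : k) (x : heisenberg v) : c *: x = (c%:P *: (x : zheis)) :> zheis.
Proof. by []. Qed.

Lemma zpi_rho i : zpi (rho k i) = (v i *: 'X) *: zpi (idem (i : vertex DQ)).
Proof.
rewrite -zpiZ; apply/qpi_eq; apply: ideal_gen_in; by exists i.
Qed.

Inductive zspan_lt (m : nat) : zheis -> Prop :=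
| zspan_lt0 : zspan_lt m 0
| zspan_ltD x y of zspan_lt m x & zspan_lt m y : zspan_lt m (x + y)
| zspan_ltZ c x of zspan_lt m x : zspan_lt m (c *: x)
| zspan_lt_path (p : qpath DQ) of (size (pseq p) < m)%N : zspan_lt m (zpi (pbasis p)).

Lemma zspan_ltMl p m y : zspan_lt m y ->
  zspan_lt (size (pseq p) + m) (zpi (pbasis p) * y).
Proof.
elim=> [|x z _ hx _ hz|c x _ hx|q qm].
- by rewrite mulr0; exact: zspan_lt0.
- by rewrite mulrDr; exact: zspan_ltD.
- by rewrite -zscalerAr; exact: zspan_ltZ.
rewrite -zpiM pbasisM /pbmul; case E: Defs.pcomp => [r|]; last by rewrite zpi0; exact: zspan_lt0.
by apply: zspan_lt_path; rewrite (pbmul_size E) ltn_add2l.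
Qed.

Lemma zspan_ltMr p m y : zspan_lt m y ->
  zspan_lt (m + size (pseq p)) (y * zpi (pbasis p)).
Proof.
elim=> [|x z _ hx _ hz|c x _ hx|q qm].
- by rewrite mul0r; exact: zspan_lt0.
- by rewrite mulrDl; exact: zspan_ltD.
- by rewrite -zscalerAl; exact: zspan_ltZ.
rewrite -zpiM pbasisM /pbmul; case E: Defs.pcomp => [r|]; last by rewrite zpi0; exact: zspan_lt0.
by apply: zspan_lt_path; rewrite (pbmul_size E) ltn_add2r.
Qed.

Let eps (x : pathalg k DQ) : heisenberg v := plift (fun p => zpi (pbasis p) : heisenberg v) x.

Let epsD x y : eps (x + y) = eps x + eps y. Proof. exact: linearD. Qed.
Let epsZ c x : eps (c *: x) = (c%:P *: (eps x : zheis)) :> zheis.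
Proof. by rewrite -heis_scaleE /eps linearZ. Qed.
Let eps0 : eps 0 = 0. Proof. exact: linear0. Qed.
Let epsB x y : eps (x - y) = eps x - eps y. Proof. exact: linearB. Qed.
Let eps_basis p : eps (pbasis p) = zpi (pbasis p). Proof. exact: plift_basis. Qed.

Let epsM_basis p q : eps (pbasis p * pbasis q) = (eps (pbasis p) * eps (pbasis q) : zheis).
Proof.
rewrite !eps_basis -zpiM !pbasisM /pbmul; case: Defs.pcomp => [r|].
  by rewrite eps_basis.
by rewrite eps0 zpi0.
Qed.

Let epsMl p x : eps (pbasis p * x) = (eps (pbasis p) * eps x : zheis).
Proof.
elim/pathalg_basis_ind: x => [|x y hx hy|c x hx|q]; last exact: epsM_basis.
- by rewrite mulr0 eps0 [RHS]mulr0.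
- by rewrite mulrDr !epsD hx hy [RHS]mulrDr.
- by rewrite -pathalg_scalerAr !epsZ hx zscalerAr.
Qed.

Let epsMr p x : eps (x * pbasis p) = (eps x * eps (pbasis p) : zheis).
Proof.
elim/pathalg_basis_ind: x => [|x y hx hy|c x hx|q]; last exact: epsM_basis.
- by rewrite mul0r eps0 [RHS]mul0r.
- by rewrite mulrDl !epsD hx hy [RHS]mulrDl.
- by rewrite -pathalg_scalerAl !epsZ hx zscalerAl.
Qed.

(* The homogeneous relation [prho i] of degree 2 becomes [v i z e_i], which has
   degree 0 over [k[z]]. *)
Lemma hrel_zspan_lt d x : hrel d x -> zspan_lt d (eps x).
Proof.
elim=> {d x} [i|d|d x y _ hx _ hy|d c x _ hx|d p x _ hx|d p x _ hx].
- have -> : eps (prho k i) = zpi (rho k i).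
    rewrite /prho /rho epsB zpiD zpiN !(big_morph eps epsD eps0).
    rewrite !(big_morph zpi zpiD zpi0); congr (_ - _); apply: eq_bigr => a _;
    by rewrite [LHS]epsM_basis !eps_basis -zpiM.
  by rewrite zpi_rho; apply: zspan_ltZ; exact: (@zspan_lt_path 2 (@ptriv DQ i)).
- by rewrite eps0; exact: zspan_lt0.
- by rewrite epsD; exact: zspan_ltD.
- by rewrite epsZ; exact: zspan_ltZ.
- by rewrite epsMl eps_basis; exact: zspan_ltMl.
- by rewrite epsMr eps_basis; exact: zspan_ltMr.
Qed.

(** A path that vanishes in the preprojective algebra becomes, in the Heisenberg algebra, a
    k[z]-combination of strictly shorter paths; rewriting terminates at paths of length below L. *)
Lemma zheis_fingen : dynkin Q -> exists s : seq zheis, forall y, seqspan s y.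
Proof.
move=> dQ; have [L HL] := preprojective_nilpotent k dQ.
exists [seq zpi (pbasis p) | p <- paths_lt DQ L] => y.
have [w <-] := zpi_surj y.
elim/pathalg_basis_ind: w => [|x z hx hz|c x hx|p].
- by rewrite zpi0; exact: seqspan0.
- by rewrite zpiD; exact: seqspanD.
- by rewrite zpiZ; exact: seqspanZ.
have [n] := ubnP (size (pseq p)); elim: n p => // n IH p; rewrite ltnS => pn.
have [pL|Lp] := ltnP (size (pseq p)) L.
  by apply: seqspan_mem; apply: map_f; exact: mem_paths_lt.
suff : zspan_lt (size (pseq p)) (zpi (pbasis p)).
  elim=> [|x z _ hx _ hz|c x _ hx|q qp].
  - exact: seqspan0.
  - exact: seqspanD.
  - exact: seqspanZ.
  by apply: IH; exact: leq_trans qp pn.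
(* The vanishing degree depends on the source, so it is the initial segment of length [d] that gets
   rewritten. *)
have [d dL Hd] := HL (psrc p).
have : walk (psrc p) (take d (pseq p) ++ drop d (pseq p)).
  by rewrite cat_take_drop; exact: valP p.
rewrite walk_cat => /andP[w1 w2].
pose p1 : qpath DQ := @QPath DQ (psrc p, take d (pseq p)) w1.
pose p2 : qpath DQ := @QPath DQ (last (psrc p) (map (@ahead DQ) (take d (pseq p))), drop d (pseq p)) w2.
have dp : (d <= size (pseq p))%N by lia.
have s1 : size (pseq p1) = d by rewrite /p1 /pseq /= size_take_min; apply/minn_idPl.
have -> : pbasis p = pbasis p1 * pbasis p2 :> kzQ.
  rewrite pbasisM /pbmul (_ : Defs.pcomp _ _ = Some p) //; apply/pcompP; split=> //.
  by rewrite /p1 /p2 /pseq /= cat_take_drop.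
rewrite zpiM; have s2 : (size (pseq p) = d + size (pseq p2))%N.
  by rewrite /p2 [in RHS]/pseq /= size_drop subnKC.
rewrite [X in zspan_lt X]s2; apply: zspan_ltMr.
by rewrite -eps_basis; apply: hrel_zspan_lt; apply: Hd.
Qed.

End HeisenbergOverPoly.

(** * The two implications *)

(** Regularity speaks of indecomposables only, so the representation is cut down by a nonzero
    idempotent endomorphism [P] of least rank, whose image is indecomposable; the relation is then
    traced against [P]. *)
Lemma regular_no_lift (k : fieldType) (Q : quiver) (v : {ffun vertex Q -> k}) n
    (E : vertex Q -> 'M[k]_n) (A S : arrow Q -> 'M[k]_n) :
  regular_weight v -> qrep E A ->
  \sum_a (A a *m S a - S a *m A a) = \sum_i v i *: E i -> n = 0%N.
Proof.
move=> reg EA lift; apply/eqP; case: (posnP n) => [//|n0]; exfalso.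
have one_neq0 : (1%:M : 'M[k]_n) != 0 by rewrite -mxrank_eq0 mxrank1 -lt0n.
have [P [hP PP P0] Pmin] := @ex_min_rank k n n
  (fun P => [/\ qhom E A E A P, P *m P = P & P != 0])
  (ex_intro _ 1%:M (And3 (qhom1 E A) (mulmx1 _) one_neq0)).
(* [P] is known to commute with the [A a] only, which suffices: S A P = S P A has the same trace as
   A S P. *)
have trP : \sum_i v i * \tr (E i *m P) = 0.
  have -> : \sum_i v i * \tr (E i *m P) = \tr ((\sum_i v i *: E i) *m P).
    rewrite mulmx_suml raddf_sum; apply: eq_bigr => i _.
    by rewrite /= -scalemxAl mxtraceZ.
  rewrite -lift mulmx_suml raddf_sum big1 // => a _ /=.
  by rewrite mulmxBl raddfB /= -[S a *m A a *m P]mulmxA hP.2 mulmxA [X in _ - X]mxtrace_mulC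
     mulmxA subrr.
have [[p i] /= pi ip] := idem_factor PP.
have := hP; rewrite -pi => hpi.
have [EAL hi hp] := qrep_retract EA hpi ip.
have [N indN dN] : exists2 N : kQmodule k Q, indecomposable N
    & forall j, \dim (limg (modact N (idem j))) = \rank (i *m E j *m p).
  apply: (qrep_kQmodule EAL); split; first by rewrite lt0n mxrank_eq0.
  move=> R hR RR; have [z|nz] := eqVneq (p *m R *m i) 0.
    left; have := congr1 (fun X => i *m X *m p) z.
    by rewrite mulmx0 mul0mx !mulmxA ip mul1mx -mulmxA ip mulmx1.
  right; have uR : R \in unitmx.
    rewrite -row_free_unit -row_leq_rank.
    apply: leq_trans (leq_trans (mxrankM_maxl (p *m R) i) (mxrankM_maxr p R)).
    apply: Pmin; split=> //; first exact: qhom_comp (qhom_comp hp hR) hi.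
    by rewrite -!mulmxA (mulmxA i) ip mul1mx (mulmxA R) RR.
  by rewrite -[R](mulKmx uR) RR mulVmx.
have := reg N indN; case/eqP; rewrite -[RHS]trP; apply: eq_bigr => j _.
rewrite dN -idem_mxtrace; last exact: (qrepEE EAL).
by rewrite mxtrace_mulC mulmxA pi mxtrace_mulC.
Qed.

(** * The fibre at z = 1 and finite dimension *)

Section FiniteDimensional.
Variables (k : fieldType) (Q : quiver) (v : {ffun vertex Q -> k}).
Local Notation DQ := (double_quiver Q).
Local Notation kzQ := (pathalg {poly k} DQ).
Local Notation zpi := (@zpi k Q v).
Local Notation zheis := (zheis v).

(** If the fibre at z = 1 were nonzero, right multiplication would make it a representation of Q for
    which the reversed arrows supply the lift excluded by [regular_no_lift]. *)
Lemma zheis_fixed (s : seq zheis) : regular_weight v ->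
  (forall y, seqspan s y) -> forall y : zheis, exists y' : zheis, y = ('X - 1) *: y'.
Proof.
move=> reg fs.
pose W (y : heisenberg v) := exists y' : zheis, y = ('X - 1) *: y' :> zheis.
have W0 : W 0 by exists 0; rewrite scaler0.
have WD x y : W x -> W y -> W (x + y).
  by move=> [x' ->] [y' ->]; exists (x' + y'); rewrite scalerDr.
have WZ c x : W x -> W (c *: x).
  by move=> [x' ->]; exists (c%:P *: x'); rewrite heis_scaleE !scalerA mulrC.
have [|n [f [lf sf kf]]] := fincodim_coord W0 WD WZ (s := s : seq (heisenberg v)).
  move=> x; have [c xc] := fs x.
  exists (\sum_(j < size s) ((c j).[1] *: (s`_j : heisenberg v) : heisenberg v)).
    by exists (fun j => (c j).[1]).
  (* Modulo z - 1 a polynomial acts by its value at 1, so generators over k[z] span the fibre over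
     k. *)
  have q j : exists q, c j = (c j).[1]%:P + q * ('X - 1).
    have /factor_theorem[q Hq] : root (c j - (c j).[1]%:P) 1 by rewrite rootE !hornerE subrr.
    by exists q; rewrite -Hq addrC subrK.
  exists (\sum_(j < size s) sval (cid (q j)) *: s`_j).
  rewrite [in LHS]xc -[LHS]sumrB scaler_sumr; apply: eq_bigr => j _.
  case: cid => qj /= e; rewrite [in X in X - _]e heis_scaleE scalerDl addrC addKr.
  by rewrite scalerA mulrC.
have [n0|n0] := posnP n.
  by move=> y; apply/kf; move: (f y); rewrite n0 => u; apply/rowP; case.
exfalso.
have op (g : zheis) : exists M : 'M[k]_n, forall x : zheis, f (x * g) = f x *m M.
  have lg : linear (fun x : heisenberg v => (x : zheis) * g : heisenberg v).
    by move=> c x y; rewrite mulrDl !heis_scaleE zscalerAl.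
  apply: (fincodim_mx lf sf kf lg) => x [x' ->]; exists (x' * g).
  by rewrite zscalerAl.
have [E HE] : exists E : vertex DQ -> 'M[k]_n, forall j x, f (x * zpi (idem j)) = f x *m E j.
  by exists (fun j => sval (cid (op (zpi (idem j))))) => j; case: cid.
have [B HB] : exists B : arrow DQ -> 'M[k]_n, forall b x, f (x * zpi (arr b)) = f x *m B b.
  by exists (fun b => sval (cid (op (zpi (arr b))))) => b; case: cid.
have mx_ext m (M M' : 'M[k]_(n, m)) : (forall x : zheis, f x *m M = f x *m M') -> M = M'.
  by move=> h; apply/row_matrixP => l; have [x Hx] := sf (delta_mx 0 l); rewrite !rowE -Hx.
have f0 : f 0 = 0 by apply/kf.
have fD x y : f (x + y) = f x + f y by have := lf 1 x y; rewrite !scale1r.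
have fN x : f (- x) = - f x by have := lf (-1) x 0; rewrite !scaleN1r f0 !addr0.
have fsum I (r : seq I) (F : I -> zheis) : f (\sum_(a <- r) F a) = \sum_(a <- r) f (F a).
  exact: (big_morph f fD f0).
have [ii ij i1 ta ha] := pathalg_idemP {poly k} DQ.
have EB : @qrep k Q n E (fun a : arrow Q => B (inl a)).
  split=> [j|j l jl||b|b]; apply: mx_ext => x.
  - by rewrite mulmxA -!HE -mulrA -zpiM ii.
  - by rewrite mulmxA -!HE -mulrA -zpiM ij // zpi0 mulr0 f0 mulmx0.
  - rewrite mulmx1 mulmx_sumr -[in RHS](mulr1 (x : zheis)) -zpi1 -i1.
    rewrite (big_morph zpi (@zpiD k Q v) (@zpi0 k Q v)) mulr_sumr fsum.
    by apply: eq_bigr => j _; rewrite HE.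
  - by rewrite mulmxA -HE -!HB -mulrA -zpiM; have /= -> := ta (inl b).
  - by rewrite mulmxA -!HB -HE -mulrA -zpiM; have /= -> := ha (inl b).
suff lift : \sum_a (B (inl a) *m B (inr a) - B (inr a) *m B (inl a)) = \sum_i v i *: E i.
  by move: n0; rewrite (regular_no_lift reg EB lift).
apply: mx_ext => x.
have -> : f x *m (\sum_i v i *: E i) = f ((x : zheis) * zpi (\sum_i rho k i)).
  rewrite (big_morph zpi (@zpiD k Q v) (@zpi0 k Q v)) mulr_sumr fsum mulmx_sumr.
  apply: eq_bigr => i _; rewrite zpi_rho -zscalerAr -scalemxAr -HE.
  have -> : v i *: 'X = (v i)%:P + ('X - 1) * (v i)%:P by rewrite mulrBl mul1r addrC subrK -mul_polyC mulrC.
  rewrite scalerDl fD; have -> : f ((('X - 1) * (v i)%:P) *: (x * zpi (idem (i : vertex DQ)) : zheis)) = 0.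
    by apply/kf; exists ((v i)%:P *: (x * zpi (idem (i : vertex DQ)))); rewrite scalerA.
  rewrite addr0 -heis_scaleE.
  by have := lf (v i) ((x : zheis) * zpi (idem (i : vertex DQ))) 0; rewrite f0 !addr0.
have -> : \sum_i rho k i = \sum_(a : arrow Q) (orig k a * star k a - star k a * orig k a).
  rewrite !sumrB; congr (_ - _).
    by rewrite [RHS](partition_big (fun a : arrow Q => atail a) xpredT).
  by rewrite [RHS](partition_big (fun a : arrow Q => ahead a) xpredT).
rewrite (big_morph zpi (@zpiD k Q v) (@zpi0 k Q v)) mulr_sumr fsum mulmx_sumr.
apply: eq_bigr => a _.
by rewrite zpiD zpiN !zpiM mulrBr fD fN mulmxBr !mulmxA !mulrA !HB.
Qed.

(* Cayley-Hamilton: since [zheis = (z - 1) zheis] is finitely generated over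
   [k[z]], it is killed by a polynomial taking the value 1 at [z = 1]. *)
Theorem regular_finite_dim : dynkin Q -> regular_weight v -> finite_dim (heisenberg v).
Proof.
move=> dQ reg; have [s fs] := zheis_fingen v dQ.
have fix1 := zheis_fixed reg fs.
set N := size s in fs.
have [C HC] : exists C : 'M[{poly k}]_N, forall j : 'I_N,
    s`_j = ('X - 1) *: (\sum_l C j l *: s`_l).
  have ex (j : 'I_N) : exists c : nat -> {poly k}, s`_j = ('X - 1) *: (\sum_(l < N) c l *: s`_l).
    by have [y' ->] := fix1 s`_j; have [c ->] := fs y'; exists c.
  exists (\matrix_(j, l) sval (cid (ex j)) l) => j.
  rewrite [LHS](svalP (cid (ex j))); congr (_ *: _).
  by apply: eq_bigr => l _; rewrite mxE.
(* [M] kills the vector of generators, hence so does its determinant by the adjugate; at z = 1 it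
   becomes the identity matrix. *)
pose M : 'M[{poly k}]_N := 1%:M - ('X - 1) *: C.
have Ms j : \sum_l M j l *: (s`_l : zheis) = 0.
  rewrite (eq_bigr (fun l => (j == l)%:R *: (s`_l : zheis) - ('X - 1) *: (C j l *: (s`_l : zheis)))).
    rewrite sumrB -scaler_sumr -HC (bigD1 j) //= eqxx scale1r big1 ?addr0 ?subrr // => l lj.
    by rewrite eq_sym (negPf lj) scale0r.
  by move=> l _; rewrite !mxE scalerBl scalerA.
pose D := \det M.
have Ds l : D *: (s`_l : zheis) = 0.
  have [lN|Nl] := ltnP l N; last by rewrite nth_default ?scaler0.
  have adjM j : \sum_i (\adj M) (Ordinal lN) i * M i j = D *+ (Ordinal lN == j).
    by have /matrixP/(_ (Ordinal lN) j) := mul_adj_mx M; rewrite !mxE.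
  have : \sum_i (\adj M) (Ordinal lN) i *: (\sum_j M i j *: (s`_j : zheis)) = 0.
    by rewrite big1 // => i _; rewrite Ms scaler0.
  under eq_bigr do rewrite scaler_sumr.
  rewrite exchange_big /= (bigD1 (Ordinal lN)) //= [X in _ + X]big1 => [|j jl].
    rewrite addr0; under eq_bigr do rewrite scalerA.
    by rewrite -scaler_suml adjM eqxx.
  under eq_bigr do rewrite scalerA.
  by rewrite -scaler_suml adjM eq_sym (negPf jl) scale0r.
have D0 : D != 0.
  apply/negP => /eqP D0; have := congr1 (horner^~ 1) D0; rewrite /= horner0.
  rewrite -[_.[1]]/(horner_eval 1 D) -det_map_mx.
  have -> : map_mx (horner_eval 1) M = 1%:M.
    apply/matrixP => i j; rewrite !mxE /horner_eval !hornerE subrr mul0r subr0.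
    by rewrite hornerMn hornerC.
  by rewrite det1 => /eqP; rewrite oner_eq0.
(* Division by [D] leaves remainders of size below [size D], so these powers of z suffice. *)
exists [seq ('X^i *: (s`_j : zheis) : heisenberg v) | i <- iota 0 (size D), j <- iota 0 N] => x.
suff : seqspan [seq ('X^i *: (s`_j : zheis) : heisenberg v) | i <- iota 0 (size D), j <- iota 0 N] x.
  by [].
have [c ->] := fs x; apply: seqspan_sum => j.
rewrite (divp_eq (c j) D) scalerDl -scalerA Ds scaler0 add0r.
rewrite -[c j %% D]coefK poly_def scaler_suml.
apply: seqspan_sum => i.
rewrite -mul_polyC -scalerA -heis_scaleE; apply: seqspanZ; apply: seqspan_mem.
apply: allpairs_f; rewrite mem_iota add0n /=; last exact: ltn_ord.
by apply: leq_trans (ltn_ord i) _; apply: ltnW; rewrite ltn_modp.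
Qed.

End FiniteDimensional.

(** * Finite dimension forces regularity *)

Section Infinite.
Variables (k : fieldType) (Q : quiver) (v : {ffun vertex Q -> k}).
Local Notation DQ := (double_quiver Q).
Local Notation kzQ := (pathalg {poly k} DQ).

(* A lift [S] of the representation [(E, A)] to the relations [rho i = v i] turns
   [k[z] (x) N] into a module over the Heisenberg algebra, with [a^*] acting by
   [z S a]; hence no nonzero polynomial in [z] vanishes. *)
Lemma lift_torsion_free n (E : vertex Q -> 'M[k]_n) (A S : arrow Q -> 'M[k]_n) :
  (0 < n)%N -> qrep E A ->
  (forall a, E (ahead a) *m S a = S a /\ S a *m E (atail a) = S a) ->
  \sum_a (A a *m S a - S a *m A a) = \sum_i v i *: E i ->
  forall p : {poly k}, qpi (heisenberg_rel v) (p *: (1 : kzQ)) = 0 -> p = 0.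
Proof.
move=> n0 EA ES lift p p0.
pose E' (i : vertex DQ) : 'M[{poly k}]_n := map_mx polyC (E i).
pose A' (b : arrow DQ) : 'M[{poly k}]_n :=
  match b with inl a => map_mx polyC (A a) | inr a => 'X *: map_mx polyC (S a) end.
have EA' : @qrep _ DQ n E' A'.
  split=> [i|i j ij||[a|a]|[a|a]] /=; rewrite /E'.
  - by rewrite -map_mxM (qrepEE EA).
  - by rewrite -map_mxM (qrepE0 EA) // map_mx0.
  - by rewrite -map_mx_sum (qrepE1 EA) map_mx1.
  - by rewrite -map_mxM (qrep_tail EA).
  - by rewrite -scalemxAr -map_mxM (ES a).1.
  - by rewrite -map_mxM (qrep_head EA).
  - by rewrite -scalemxAl -map_mxM (ES a).2.
have [F [lF FM F1 Fi Fa]] := pathalg_eval EA'.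
have F0 : F 0 = 0 by exact: (linear_fun0 lF).
have FD x y : F (x + y) = F x + F y by have := lF 1 x y; rewrite !scale1r.
have FZ c x : F (c *: x) = c *: F x by have := lF c x 0; rewrite F0 !addr0.
have FN x : F (- x) = - F x by rewrite -scaleN1r FZ scaleN1r.
have Frho i : F (rho k i) = (v i *: 'X) *: E' i.
  rewrite /rho FD FN !(big_morph F FD F0).
  (* Multiplying the summed relation by [E i] isolates the terms of the arrows that start or end at
     [i]. *)
  transitivity ('X *: map_mx polyC (E i *m \sum_a (A a *m S a - S a *m A a))); last first.
    rewrite lift mulmx_sumr (bigD1 i) //= -scalemxAr (qrepEE EA) big1 => [|j ji].
      by rewrite addr0 map_mxZ scalerA -mul_polyC mulrC.
    by rewrite -scalemxAr (qrepE0 EA) ?scaler0 // eq_sym.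
  rewrite sumrB mulmxBr !mulmx_sumr map_mxB !map_mx_sum scalerBr !scaler_sumr.
  congr (_ - _).
    rewrite big_mkcond; apply: eq_bigr => a _; case: eqP => [<-|ai].
      by rewrite mulmxA (qrep_tail EA) FM !Fa /= -scalemxAr map_mxM.
    rewrite -(qrep_tail EA) -(mulmxA (E (atail a))) (mulmxA (E i)) (qrepE0 EA) ?mul0mx ?map_mx0 ?scaler0 //.
    by apply/eqP => e; apply: ai.
  rewrite big_mkcond; apply: eq_bigr => a _; case: eqP => [<-|ai].
    by rewrite mulmxA (ES a).1 FM !Fa /= -scalemxAl map_mxM.
  rewrite -(ES a).1 -(mulmxA (E (ahead a))) (mulmxA (E i)) (qrepE0 EA) ?mul0mx ?map_mx0 ?scaler0 //.
  by apply/eqP => e; apply: ai.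
have Fker x : ideal_gen (heisenberg_rel v) x -> F x = 0.
  elim=> {x} [_ [i ->]||x y _ hx _ hy|a x _ hx|a x _ hx] //.
  - by rewrite FD FN FZ Frho Fi subrr.
  - by rewrite FD hx hy addr0.
  - by rewrite FM hx mulmx0.
  - by rewrite FM hx mul0mx.
have : F (p *: (1 : kzQ)) = 0.
  apply: Fker; rewrite -[_ *: _]subr0; apply/qpi_eq.
  by rewrite p0 (raddf0 (qpi (heisenberg_rel v))).
rewrite FZ F1 => /matrixP/(_ (Ordinal n0) (Ordinal n0)).
by rewrite !mxE eqxx mulr1.
Qed.

Lemma finite_dim_torsion : finite_dim (heisenberg v) ->
  exists2 p : {poly k}, p != 0 & qpi (heisenberg_rel v) (p *: (1 : kzQ)) = 0.
Proof.
move=> [s hs].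
pose e i : heisenberg v := qpi (heisenberg_rel v) ('X^i *: (1 : kzQ)).
pose c i := sval (cid (hs (e i))).
have Hc i : e i = \sum_(j < size s) c i j *: s`_j := svalP (cid (hs (e i))).
(* One more power of z than spanning elements: a vector in the left kernel gives the coefficients of
   the polynomial. *)
pose M : 'M[k]_((size s).+1, size s) := \matrix_(i, j) c i j.
have : kermx M != 0.
  by rewrite kermx_eq0 /row_free; have := rank_leq_col M; case: eqP => // ->; rewrite ltnn.
move=> /rowV0Pn[u /sub_kermxP uM u0].
exists (\poly_(i < (size s).+1) u 0 (inord i)).
  apply: contraNneq u0 => p0; apply/eqP/rowP => i; rewrite mxE.
  have := congr1 (fun q : {poly k} => q`_i) p0.
  by rewrite coef_poly ltn_ord inord_val coef0.
rewrite poly_def scaler_suml (raddf_sum (qpi (heisenberg_rel v))).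
transitivity (\sum_(i < (size s).+1) u 0 i *: e i).
  apply: eq_bigr => i _; rewrite inord_val /e heisenberg_scaleE.
  by rewrite scalerA mul_polyC.
under eq_bigr do rewrite Hc scaler_sumr.
rewrite exchange_big big1 // => j _.
under eq_bigr do rewrite scalerA.
rewrite -scaler_suml; have /rowP/(_ j) := uM; rewrite !mxE => uMj.
rewrite (_ : \sum_i _ = 0) ?scale0r // -[RHS]uMj.
by apply: eq_bigr => i _; rewrite mxE.
Qed.

Theorem finite_dim_regular : dynkin Q -> finite_dim (heisenberg v) -> regular_weight v.
Proof.
move=> dQ fd N indN; apply/eqP => s0.
have [n [E [A [EA ind dE]]]] := kQmodule_qrep indN.
have posQ := dynkin_tits_positive dQ.
have brick := indec_brick posQ EA ind.
have [|S ES lift] := brick_lift EA (brick_scalar EA posQ brick) (v := v).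
  by rewrite -[RHS]s0; apply: eq_bigr => i _; rewrite dE.
have [p /eqP p0 pz] := finite_dim_torsion fd.
exact: p0 (lift_torsion_free ind.1 EA ES lift pz).
Qed.

End Infinite.

Theorem theorem1p19 (k : fieldType) (Q : quiver) (v : {ffun vertex Q -> k}) :
  dynkin Q -> (finite_dim (heisenberg v) <-> regular_weight v).
Proof.
by move=> dQ; split; [exact: finite_dim_regular | exact: regular_finite_dim].
Qed.
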